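(* Let $Q$ be a finite quiver with arrows $Q_1=\{z_1,\dots,z_k\}$, $U\subset\mathbb C$ an open subset containing $0$, and $\mathbf F(z,t)=(F_a(t))_{a\in Q_1}$ a vector of analytic $U$-families of noncommutative series $F_a(t)=\sum_{|w|>0}\lambda_{a,w}(t)\,w$, where only paths $w$ with the same source and target as $a$ occur. Consider the initial value problem $\partial_t\mathbf u(z,t)=\mathbf F(\mathbf u(z,t),t)$, $\mathbf u(z,0)=z$, for $\mathbf u(z,t)=(u_b(z,t))_{b\in Q_1}$, $u_b(z,t)=\sum_w\gamma_{b,w}(t)w$; that is, for all $b\in Q_1$ and all paths $w$, the system $$\begin{cases}\gamma_{b,w}'(t)=\sum_{w=u_1u_2\cdots u_d}\ \sum_{a_1,\dots,a_d\in Q_1}\lambda_{b,a_1\cdots a_d}(t)\,\gamma_{a_1,u_1}(t)\cdots\gamma_{a_d,u_d}(t),\\ \gamma_{b,w}(t)=0\ \text{ if } s(b)\ne s(w)\text{ or }t(b)\neq t(w),\\ \gamma_{b,a}(0)=\delta_{b,a}\ (a\in Q_1),\\ \gamma_{b,w}(0)=0\ \text{ if }|w|\ge2.\end{cases}$$ Then there exists a neighbourhood $V$ of $0$ such that this system has a unique analytic solution $\gamma_{b,w}(t)$ on $V$ for every $b\in Q_1$ and every path $w$, and $\mathbf u(z,t)=(u_b(z,t))_{b\in Q_1}$ is invertible (i.e. for $t\in V$ the endomorphism $b\mapsto u_b(z,t)$ of $\widehat{\mathbb CQ}$ is an automorphism). Moreover, $\mathbf u(z,t)$ is a vector of analytic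 $V$-families of series.
   Context: $\widehat{\mathbb CQ}$ is the completed path algebra of $Q$ over $\mathbb C$; endomorphisms are $\mathbb CQ_0$-algebra endomorphisms, determined by the images of the arrows; $|w|$ is the length of a path $w$. In the system, decompositions $w=u_1\cdots u_d$ are into paths of length $\ge1$, and $\lambda_{b,a_1\cdots a_d}$ is $0$ if $a_1\cdots a_d$ is not a path. A $U$-family of formal noncommutative series is a formal series $\sum_w\lambda_w(t)w$ over paths $w$ whose coefficients $\lambda_w$ are analytic functions on $U$. It is analytic if there is a constant $C>0$ with $|\lambda_w(t)|\le C^{|w|}$ for all $t\in U$ and all $w$. *)

(* Defs.v *)
From HB Require Import structures.
From mathcomp Require Import all_boot all_order all_algebra complex.
From mathcomp Require Import mathcomp_extra boolp classical_sets functions.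
From mathcomp Require Import cardinality fsbigop reals topology normedtype.
From mathcomp Require Import sequences derive.

Set Implicit Arguments.
Unset Strict Implicit.
Unset Printing Implicit Defensive.

Import Order.TTheory GRing.Theory Num.Theory.
Import numFieldNormedType.Exports.

Local Open Scope classical_set_scope.
Local Open Scope ring_scope.

Record quiver := Quiver {
  vertex : finType;
  arrow : finType;
  src : arrow -> vertex;
  tgt : arrow -> vertex }.

Section Paths.
Variable Q : quiver.

(* Paths are read from left to right: z_1 z_2 is a path when the target of
   z_1 is the source of z_2. *)
Fixpoint walk (v : vertex Q) (s : seq (arrow Q)) : bool :=
  if s is a :: s' then (src a == v) && walk (tgt a) s' else true.

(* The starting vertex is recorded, so that there is one trivial path (of
   length 0) at each vertex. *)
Record qpath := QPath {
  pval : vertex Q * seq (arrow Q);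
  _ : walk pval.1 pval.2 }.

HB.instance Definition _ := [isSub for pval].
HB.instance Definition _ := [Choice of qpath by <:].

Definition psrc (w : qpath) : vertex Q := (val w).1.
Definition parrows (w : qpath) : seq (arrow Q) := (val w).2.
Definition ptgt (w : qpath) : vertex Q :=
  last (psrc w) [seq tgt a | a <- parrows w].
Definition plen (w : qpath) : nat := size (parrows w).

Lemma walk_parrows w : walk (psrc w) (parrows w).
Proof. exact: valP w. Qed.

Lemma qpath_inj (w w' : qpath) :
  psrc w = psrc w' -> parrows w = parrows w' -> w = w'.
Proof.
move=> e1 e2; apply: val_inj; move: e1 e2; rewrite /psrc /parrows.
by case: (val w) => ? ?; case: (val w') => ? ? /= -> ->.
Qed.

Definition ptriv (v : vertex Q) : qpath := @QPath (v, [::]) isT.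

Fact walk1 (a : arrow Q) : walk (src a) [:: a].
Proof. by rewrite /= eqxx. Qed.
Definition parrow (a : arrow Q) : qpath := @QPath (src a, [:: a]) (walk1 a).

Definition parallel (a : arrow Q) (w : qpath) : bool :=
  (src a == psrc w) && (tgt a == ptgt w).

Lemma walk_cat v s1 s2 :
  walk v (s1 ++ s2) =
  walk v s1 && walk (last v [seq tgt a | a <- s1]) s2.
Proof. by elim: s1 v => //= a s1 IH v; rewrite IH andbA. Qed.

(* [ptake j w] and [pdrop j w] are the two factors of w at position j. *)
Fact walk_take w j : walk (psrc w) (take j (parrows w)).
Proof.
by have := walk_parrows w; rewrite -{1}(cat_take_drop j (parrows w)) walk_cat => /andP[].
Qed.
Definition ptake (j : nat) (w : qpath) : qpath :=
  @QPath (psrc w, take j (parrows w)) (walk_take w j).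

Fact walk_drop w j : walk (ptgt (ptake j w)) (drop j (parrows w)).
Proof.
by have := walk_parrows w; rewrite -{1}(cat_take_drop j (parrows w)) walk_cat => /andP[].
Qed.
Definition pdrop (j : nat) (w : qpath) : qpath :=
  @QPath (ptgt (ptake j w), drop j (parrows w)) (walk_drop w j).

Lemma ptake0 w : ptake 0 w = ptriv (psrc w).
Proof. by apply: qpath_inj => //; rewrite /parrows /= take0. Qed.

Lemma pdrop0 w : pdrop 0 w = w.
Proof.
by apply: qpath_inj; [rewrite {1}/psrc /= ptake0 | rewrite /parrows /= drop0].
Qed.

Lemma ptake_size w : ptake (plen w) w = w.
Proof. by apply: qpath_inj => //; rewrite /parrows /= take_size. Qed.

Lemma plen_take j w : (j <= plen w)%N -> plen (ptake j w) = j.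
Proof. by move=> h; rewrite /plen /parrows /= size_takel. Qed.

Lemma plen_drop j w : plen (pdrop j w) = (plen w - j)%N.
Proof. by rewrite /plen /parrows /= size_drop. Qed.

Lemma ptake_take i j w : (i <= j)%N -> ptake i (ptake j w) = ptake i w.
Proof. by move=> h; apply: qpath_inj => //; rewrite /parrows /= take_takel. Qed.

Lemma ptake_drop i j w : ptake i (pdrop j w) = pdrop j (ptake (i + j) w).
Proof.
apply: qpath_inj; last by rewrite /parrows /= take_drop.
by rewrite /psrc /= ptake_take // leq_addl.
Qed.

Lemma pdrop_drop i j w : pdrop i (pdrop j w) = pdrop (i + j) w.
Proof.
apply: qpath_inj; last by rewrite /parrows /= drop_drop.
rewrite /psrc /= -/(ptgt _).
by rewrite /ptgt /= /psrc /= /parrows /= (addnC i j) takeD map_cat last_cat.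
Qed.

(* The path a_1 ... a_d, if the arrows do compose; d = 0 is excluded, since
   the empty word determines no vertex. *)
Definition word_path (s : seq (arrow Q)) : option qpath :=
  if s is a :: _ then insub (src a, s) else None.

(* The decompositions w = u_1 ... u_d with d >= 1 into paths of length >= 1.
   As the u_i are nontrivial, they concatenate to w as soon as their words of
   arrows do. *)
Definition decompositions (w : qpath) : set (seq (qpath)) :=
  [set us | [/\ us != [::], all (fun u => (0 < plen u)%N) us &
                flatten [seq parrows u | u <- us] = parrows w]].

Lemma finite_decompositions w : finite_set (decompositions w).
Proof.
pose n := plen w.
pose g (k : n.-bseq 'I_n.+1) : seq qpath :=
  pmap word_path (reshape [seq val i | i <- k] (parrows w)).
suff sub : decompositions w `<=` g @` setT.
  by apply: sub_finite_set sub _; apply: finite_image; exact: finite_finset.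
move=> us [_ pos cat_us].
have word_pathK u : (0 < plen u)%N -> word_path (parrows u) = Some u.
  move=> u_gt0; have := walk_parrows u; have := u_gt0; rewrite /plen.
  case E: (parrows u) => [//|a s] _ wu; rewrite /word_path.
  have /andP[/eqP ea _] := wu; rewrite ea insubT; congr Some.
  by apply: qpath_inj => //; rewrite /parrows.
pose sh := [seq plen u | u <- us].
have shE : sh = shape [seq parrows u | u <- us].
  by rewrite /shape -map_comp.
have sum_sh : sumn sh = n by rewrite shE -size_flatten cat_us.
have sh_le : all (fun m => m < n.+1)%N sh.
  rewrite -sum_sh; elim: (sh) => //= m s /allP IH; rewrite ltnS leq_addr /=.
  by apply/allP => x /IH; rewrite !ltnS => /leq_trans; apply; exact: leq_addl.
have sz : (size [seq (inord m : 'I_n.+1) | m <- sh] <= n)%N.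
  rewrite size_map -sum_sh /sh; elim: (us) pos => //= u s IH /andP[u0 s0].
  by rewrite -add1n leq_add ?IH.
exists (Bseq sz) => //.
rewrite /g /= -map_comp (_ : [seq _ | _ <- sh] = sh); last first.
  rewrite -[RHS]map_id; apply/eq_in_map => m /(allP sh_le) h /=.
  by rewrite inordK.
rewrite shE -cat_us flattenK.
elim: (us) pos => //= u s IH /andP[u0 s0].
by rewrite word_pathK //= IH.
Qed.

End Paths.

(* The completed path algebra: all formal sums of paths, a series being the
   function which maps a path to its coefficient. *)
Section CompletedPathAlgebra.
Variables (K : nzRingType) (Q : quiver).

Definition cpathalg : Type := qpath Q -> K^o.

HB.instance Definition _ := GRing.Lmodule.copy cpathalg (qpath Q -> K^o).

Implicit Types f g h : cpathalg.

Definition cpone : cpathalg := fun w => (plen w == 0%N)%:R.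
Definition cpmul f g : cpathalg :=
  fun w => \sum_(j < (plen w).+1) f (ptake j w) * g (pdrop j w).

Fact cpmulA : associative cpmul.
Proof.
move=> f g h; apply/funext => w; rewrite /cpmul.
pose n := plen w.
pose F i j := f (ptake i w) * (g (pdrop i (ptake j w)) * h (pdrop j w)).
transitivity (\sum_(0 <= i < n.+1) \sum_(0 <= j < n.+1 | (i <= j)%N) F i j).
  rewrite big_mkord; apply: eq_bigr => i _.
  have lin : (i <= n)%N by rewrite -ltnS.
  rewrite mulr_sumr plen_drop -/n -subSn //.
  transitivity (\sum_(i <= j < n.+1) F i j).
    rewrite -[X in index_iota X]add0n big_addn big_mkord; apply: eq_bigr => j _.
    by rewrite /F ptake_drop pdrop_drop.
  by rewrite (big_nat_widenl i 0).
rewrite (exchange_big_dep_nat xpredT) //= big_mkord.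
apply: eq_bigr => j _.
have ljn : (j <= n)%N by rewrite -ltnS.
rewrite mulr_suml plen_take //.
transitivity (\sum_(0 <= i < j.+1) F i j).
  by rewrite [RHS](big_nat_widen _ _ n.+1).
rewrite big_mkord; apply: eq_bigr => i _.
by rewrite /F ptake_take ?mulrA // -ltnS.
Qed.

Fact cpmul1l : left_id cpone cpmul.
Proof.
move=> f; apply/funext => w; rewrite /cpmul big_ord_recl /= pdrop0 ptake0.
rewrite {1}/cpone mul1r big1 ?addr0 // => j _.
by rewrite /cpone plen_take ?mul0r.
Qed.

Fact cpmul1r : right_id cpone cpmul.
Proof.
move=> f; apply/funext => w; rewrite /cpmul big_ord_recr /= ptake_size.
rewrite {2}/cpone plen_drop subnn mulr1 big1 ?add0r // => j _.
by rewrite /cpone plen_drop subn_eq0 leqNgt ltn_ord mulr0.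
Qed.

Fact cpmulDl : left_distributive cpmul +%R.
Proof.
move=> f g h; apply/funext => w; rewrite /cpmul -[RHS]big_split /=.
by apply: eq_bigr => j _; rewrite mulrDl.
Qed.

Fact cpmulDr : right_distributive cpmul +%R.
Proof.
move=> f g h; apply/funext => w; rewrite /cpmul -[RHS]big_split /=.
by apply: eq_bigr => j _; rewrite mulrDr.
Qed.

HB.instance Definition _ := GRing.Zmodule_isPzRing.Build cpathalg
  cpmulA cpmul1l cpmul1r cpmulDl cpmulDr.

Definition path_series (p : qpath Q) : cpathalg := fun w => (w == p)%:R.

(* A CQ_0-algebra structure is given by the images of the idempotents e_v, so
   CQ_0-algebra endomorphisms are the algebra endomorphisms fixing all e_v. *)
Definition is_endo (phi : cpathalg -> cpathalg) : Prop :=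
  [/\ linear phi, monoid_morphism phi &
      forall v, phi (path_series (ptriv v)) = path_series (ptriv v)].

(* The assignment b |-> u_b extends to exactly one endomorphism, and this
   endomorphism is an automorphism. *)
Definition invertible (u : arrow Q -> cpathalg) : Prop :=
  exists phi : cpathalg -> cpathalg,
    [/\ is_endo phi,
        forall b, phi (path_series (parrow b)) = u b,
        (forall psi, is_endo psi ->
           (forall b, psi (path_series (parrow b)) = u b) -> psi =1 phi) &
        bijective phi].

End CompletedPathAlgebra.

Section AnalyticFamilies.
Variables (R : realType) (Q : quiver).
(* The regular module R[i]^o carries the topology and the norm of the complex
   plane. *)
Local Notation C := (R[i]^o).

Definition analytic_on (U : set C) (f : C -> C) : Prop :=
  forall t0, U t0 -> exists a : nat -> C,
    \forall t \near t0,
      series (fun n => a n * (t - t0) ^+ n) @ \oo --> f t.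

(* A family of formal series is given by its coefficients; only their values
   at the points of U are relevant. *)
Definition analytic_family (U : set C) (f : qpath Q -> C -> C) : Prop :=
  (forall w, analytic_on U (f w)) /\
  exists2 M : R, 0 < M &
    forall t w, U t -> `|f w t| <= (M%:C ^+ plen w)%C.

(* The coefficient of a_1 ... a_d, which is 0 if this is not a path. *)
Definition word_coef (f : qpath Q -> C -> C) (s : seq (arrow Q)) (t : C) : C :=
  if word_path s is Some w then f w t else 0.

Definition ode_rhs (lam gam : arrow Q -> qpath Q -> C -> C)
    (b : arrow Q) (w : qpath Q) (t : C) : C :=
  \sum_(us \in decompositions w) \sum_(a : (size us).-tuple (arrow Q))
    word_coef (lam b) a t *
    \prod_(i < size us) gam (tnth a i) (tnth (in_tuple us) i) t.

(* The condition at t = 0 for all w of length different from 1, including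
   length 0, is u(z,0) = z. *)
Definition ivp_solution (V : set C) (lam gam : arrow Q -> qpath Q -> C -> C)
    : Prop :=
  forall b w,
    [/\ forall t, V t -> is_derive t 1 (gam b w) (ode_rhs lam gam b w t),
        ~~ parallel b w -> forall t, V t -> gam b w t = 0,
        forall a, gam b (parrow a) 0 = (b == a)%:R &
        plen w != 1%N -> gam b w 0 = 0].

End AnalyticFamilies.

(* Main.v *)
Require Import Defs.
From mathcomp Require Import all_boot all_order all_algebra complex perm.
From mathcomp Require Import boolp classical_sets.
From mathcomp Require Import cardinality fsbigop reals topology normedtype.
From mathcomp Require Import finmap sequences derive ring lra.

(* The coefficients of u are constructed as power series in t.  An analytic
   function bounded by M on a disc of radius rho has Taylor coefficients at most
   M (2 / rho)^n at 0: by the maximum modulus principle, dividing f - f(0) by t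
   multiplies the bound by 2 / rho.  Hence all lambda_{a,w} are given on a common
   disc by power series with coefficients at most C^|w| q^n.  The system then
   becomes a recursion on the order in t, and the Taylor coefficient of order n
   of gamma_{b,w} is majorized by P A^|w| B^n / ((|w| + 1)^2 (n + 1)^2), since the
   weights 1 / (n + 1)^2 are stable under convolution up to a constant.  This
   gives convergence on a common disc and the bound A^|w|.  Uniqueness follows
   from the recursion near 0 and from the identity theorem on the disc.

   An endomorphism F is determined degree by degree by
   F(f) = f_0 + sum_a F(a) F(f_a), where f = f_0 + sum_a a f_a.  For small t
   the linear part of u is invertible; composing u with the endomorphism
   inverting it gives a map which is the identity up to terms of higher degree,
   hence bijective. *)

Set Implicit Arguments.
Unset Strict Implicit.
Unset Printing Implicit Defensive.

Import Order.TTheory GRing.Theory Num.Theory numFieldNormedType.Exports.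
Import ComplexField.
Local Open Scope classical_set_scope.
Local Open Scope ring_scope.

(** Every [lam a w] has its own power series at 0 and there are infinitely many paths w, so a common
    disc of convergence is not automatic: it has to come from the uniform bound on [U], turned into
    Taylor estimates on a square of fixed size. As analyticity means local expansions, the basic
    tool is algebraic: division of a power series by t - t0, which keeps the radius and yields
    re-expansion, derivatives and the isolation of zeros.

    A majorant has to survive two convolutions at once, one in the order in t and one over the
    decompositions of w, hence a quadratic weight in each variable. A decomposition into d factors
    costs a constant to the power d, for the words of length d and for the products; a small
    constant P in the bound of each factor gamma absorbs it. The right-hand side then lacks one
    factor P, which a large B restores in passing to the next order.

    The linear part of u is invertible for small t because its determinant is analytic in t with
    value 1 at 0. *)

Local Notation normc := (@Normc.normc _).

(** * Convergence in the complex plane *)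

Section ComplexModulus.
Variable R : realType.
Local Notation C := R[i].
Implicit Types (x y z : C) (u v : nat -> C).

Lemma normc_norm z : `|z| = ((normc z)%:C)%C.
Proof. by rewrite normc_def; case: z. Qed.

Lemma normc_ge0 z : 0 <= normc z.
Proof. by rewrite -ler0c -normc_norm. Qed.

Lemma normc_le z (e : R) : (normc z <= e) = (`|z| <= (e%:C)%C).
Proof. by rewrite normc_norm lecR. Qed.

Lemma normc_lt z (e : R) : (normc z < e) = (`|z| < (e%:C)%C).
Proof. by rewrite normc_norm ltcR. Qed.

Lemma normcD x y : normc (x + y) <= normc x + normc y.
Proof. exact: le_normcD. Qed.

Lemma normcB x y : normc (x - y) <= normc x + normc y.
Proof. by rewrite -(normcN y) normcD. Qed.

Lemma normc_distC x y : normc (x - y) = normc (y - x).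
Proof. by rewrite -normcN opprB. Qed.

Lemma normc_sub_ge x y : normc x - normc y <= normc (x - y).
Proof. by rewrite lerBlDr (le_trans _ (normcD _ _)) // subrK. Qed.

Lemma normcX x n : normc (x ^+ n) = normc x ^+ n.
Proof.
by elim: n => [|n IH]; rewrite ?expr0 ?Normc.normc1 // !exprS Normc.normcM IH.
Qed.

Lemma normc_eq0 x : (normc x == 0) = (x == 0).
Proof.
by apply/eqP/eqP => [/Normc.eq0_normc|->]; last exact: Normc.normc0.
Qed.

Lemma normc_gt0 x : (0 < normc x) = (x != 0).
Proof. by rewrite lt_def normc_ge0 andbT normc_eq0. Qed.

Lemma normc_real (e : R) : 0 <= e -> normc (e%:C)%C = e.
Proof.
by move=> e0; apply: complexI; rewrite -normc_norm ger0_norm // ler0c.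
Qed.

Lemma normc_nat n : normc n%:R = n%:R :> R.
Proof. by apply: complexI; rewrite -normc_norm normr_nat rmorph_nat. Qed.

Lemma normc_sum (I : Type) (r : seq I) (P : pred I) (F : I -> C) :
  normc (\sum_(i <- r | P i) F i) <= \sum_(i <- r | P i) normc (F i).
Proof.
elim/big_rec2: _ => [|i y x _ h]; first by rewrite Normc.normc0.
by rewrite (le_trans (normcD _ _)) // lerD2l.
Qed.

Lemma Re_le_normc z : `|complex.Re z| <= normc z.
Proof. by rewrite -lecR -normc_norm normc_ge_Re. Qed.

Lemma Im_le_normc z : `|complex.Im z| <= normc z.
Proof.
by case: z => a b /=; rewrite -sqrtr_sqr ler_wsqrtr // lerDr sqr_ge0.
Qed.

Lemma normc_le_ReIm z : normc z <= `|complex.Re z| + `|complex.Im z|.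
Proof.
case: z => a b /=; rewrite -[leRHS]ger0_norm ?addr_ge0 //.
rewrite -sqrtr_sqr ler_wsqrtr // sqrrD !real_normK ?num_real //.
by rewrite addrAC lerDl mulrn_wge0 // mulr_ge0.
Qed.

(** Phrased by a real sequence so that squeezing and real limit theorems apply; [cvgCE] identifies
    it with convergence in the complex plane. *)
Definition cvgC u x := (fun n => normc (u n - x)) @ \oo --> (0 : R).

Lemma cvgC_bound u x (v : nat -> R) :
  (forall n, normc (u n - x) <= v n) -> v @ \oo --> (0 : R) -> cvgC u x.
Proof.
move=> h v0; apply: (squeeze_cvgr _ (cvg_cst 0) v0); near=> n.
by rewrite normc_ge0 h.
Unshelve. all: by end_near. Qed.

Lemma cvgC_cst x : cvgC (fun=> x) x.
Proof.
by apply: (cvgC_bound (v := fun=> 0)) => [n|]; rewrite ?subrr ?Normc.normc0 //;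
  exact: cvg_cst.
Qed.

Lemma cvgCD u v x y : cvgC u x -> cvgC v y -> cvgC (fun n => u n + v n) (x + y).
Proof.
move=> ux vy.
apply: (cvgC_bound (v := fun n => normc (u n - x) + normc (v n - y))) => [n|].
  by rewrite opprD addrACA normcD.
by rewrite -[X in _ --> X]addr0; apply: cvgD.
Qed.

Lemma normc_cvg u x : cvgC u x -> (fun n => normc (u n)) @ \oo --> normc x.
Proof.
move=> ux; apply/subr_cvg0/norm_cvg0P; apply: (squeeze_cvgr _ (cvg_cst 0) ux).
near=> n; rewrite normr_ge0 /= ler_norml normc_sub_ge andbT lerNl opprB.
by rewrite normc_distC normc_sub_ge.
Unshelve. all: by end_near. Qed.

Lemma cvgCM u v x y : cvgC u x -> cvgC v y -> cvgC (fun n => u n * v n) (x * y).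
Proof.
move=> ux vy; have nv := normc_cvg vy.
apply: (cvgC_bound (v := fun n =>
  normc (u n - x) * normc (v n) + normc x * normc (v n - y))) => [n|].
  rewrite -!Normc.normcM.
  have -> : u n * v n - x * y = (u n - x) * v n + x * (v n - y).
    by rewrite mulrBl mulrBr addrA subrK.
  exact: normcD.
rewrite -[X in _ --> X]addr0 -[X in _ --> X + _](mul0r (normc y)).
rewrite -[X in _ --> _ + X](mulr0 (normc x)).
by apply: cvgD; apply: cvgM => //; exact: cvg_cst.
Qed.

Lemma cvgCZ u x y : cvgC u x -> cvgC (fun n => y * u n) (y * x).
Proof. by apply: cvgCM; exact: cvgC_cst. Qed.

Lemma cvgCB u v x y : cvgC u x -> cvgC v y -> cvgC (fun n => u n - v n) (x - y).
Proof.
move=> ux /(cvgCZ (-1)) vy; have := cvgCD ux vy; rewrite mulN1r.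
by congr cvgC; apply/funext => n; rewrite mulN1r.
Qed.

Lemma cvgC_uniq u x y : cvgC u x -> cvgC u y -> x = y.
Proof.
move=> ux uy; have := normc_cvg (cvgCB ux uy).
rewrite (_ : (fun _ => _) = fun=> 0); last first.
  by apply/funext => n; rewrite subrr Normc.normc0.
move=> h; have e : normc (x - y) = 0 := cvg_unique _ h (cvg_cst (0 : R)).
by apply/eqP; rewrite -subr_eq0 -normc_eq0 e.
Qed.

Lemma cvgC_shiftS u x : cvgC (fun n => u n.+1) x <-> cvgC u x.
Proof. by rewrite /cvgC -[in X in _ <-> X]cvg_shiftS. Qed.

Lemma cvgC_le u x (e : R) : cvgC u x -> (forall n, normc (u n) <= e) ->
  normc x <= e.
Proof. by move=> /normc_cvg h hu; apply: (cvgr_to_le h); near=> n.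
Unshelve. all: by end_near. Qed.

(* R[i] carries no complete structure in the library, so that absolute
   convergence is reduced to that of the real and imaginary parts. *)
Lemma abs_cvgC u (S : R) :
  (forall N, \sum_(n < N) normc (u n) <= S) ->
  exists2 l : C, cvgC (fun N => \sum_(n < N) u n) l & normc l <= S.
Proof.
move=> hS.
have part_cvg (p : C -> R) : (forall z, `|p z| <= normc z) ->
    cvgn (series (p \o u)).
  move=> hp; apply: normed_cvg.
  rewrite (_ : [normed _] = series (fun n => `|p (u n)|)) //.
  apply: nondecreasing_is_cvgn; first exact: nondecreasing_series.
  exists S => _ [N _ <-]; apply: le_trans (hS N).
  by rewrite /series /= big_mkord; apply: ler_sum => i _; exact: hp.
have cR := part_cvg _ Re_le_normc; have cI := part_cvg _ Im_le_normc.
set a := limn _ in cR; set b := limn _ in cI.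
have h : cvgC (fun N => \sum_(n < N) u n) (Complex a b).
  apply: (cvgC_bound (v := fun N => `|series (@complex.Re R \o u) N - a| +
                                    `|series (@complex.Im R \o u) N - b|)).
    move=> N; apply: le_trans (normc_le_ReIm _) _.
    by rewrite !raddfB /= /series /= !big_mkord !raddf_sum.
  have z0 (v : R^nat) (l : R) :
      v @ \oo --> l -> (fun n => `|v n - l|) @ \oo --> (0 : R).
    by move=> /subr_cvg0/cvg_norm; rewrite normr0.
  by rewrite -[0 in X in _ --> X]addr0; apply: cvgD; exact: z0.
exists (Complex a b) => //; apply: (cvgC_le h) => N.
exact: le_trans (normc_sum _ _ _) (hS N).
Qed.

Lemma nearcP (P : set R[i]^o) (x : R[i]^o) :
  (\forall t \near x, P t) <->
  exists2 e : R, 0 < e & forall t : C, normc (t - x) < e -> P t.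
Proof.
split.
- move=> /nbhs_normP[e /= e0 h].
  (* A positive element of [R[i]] is real. *)
  have [k ek] := complex_realP _ (gtr0_real e0).
  rewrite ek ltcR in e0.
  exists k => // t ht; apply: h => /=.
  by rewrite /ball_ /= distrC ek normc_norm ltcR.
- move=> [e e0 h]; apply/nbhs_normP; exists (e%:C)%C; first by rewrite /= ltcR.
  by move=> t; rewrite /ball_ /= distrC normc_norm ltcR; exact: h.
Qed.

Lemma cvgCE (u : nat -> R[i]^o) (x : R[i]^o) : u @ \oo --> x <-> cvgC u x.
Proof.
split => [/cvgrPdist_lt ux|/cvgrPdist_lt ux]; apply/cvgrPdist_lt => e e0.
  near=> n; rewrite sub0r normrN ger0_norm ?normc_ge0 // normc_lt distrC.
  by near: n; apply: ux; rewrite ltcR.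
have [k ek] := complex_realP _ (gtr0_real e0); rewrite ek ltcR in e0 *.
near=> n; rewrite distrC normc_norm ltcR -(ger0_norm (normc_ge0 _)).
by rewrite -normrN -sub0r; near: n; exact: ux.
Unshelve. all: by end_near. Qed.

End ComplexModulus.

(** * Power series *)

Section RealSums.
Variable R : realType.
Implicit Types (q : R).

Lemma geometric_sum_le q N : 0 <= q < 1 -> \sum_(n < N) q ^+ n <= (1 - q)^-1.
Proof.
move=> /andP[q0 q1]; have d0 : 0 < 1 - q by rewrite subr_gt0.
rewrite -(ler_pM2r d0) mulVf ?gt_eqF // mulrC.
have := subrXX 1 q N; rewrite expr1n => e.
rewrite (eq_bigr (fun i : 'I_N => 1 ^+ (N.-1 - i) * q ^+ i)); last first.
  by move=> i _; rewrite expr1n mul1r.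
by rewrite -e gerBl exprn_ge0.
Qed.

(** With p the square root of q, n p^n is at most the sum of the p^i for i < n, hence at most 1 / (1
    - p); the other factor p^n tends to 0. *)
Lemma cvg_natmul_expr q : 0 <= q < 1 ->
  (fun n => n%:R * q ^+ n) @ \oo --> (0 : R).
Proof.
move=> /andP[q0 q1]; set p := Num.sqrt q.
have p0 : 0 <= p := sqrtr_ge0 q.
have qE : q = p ^+ 2 by rewrite sqr_sqrtr.
have p1 : p < 1 by rewrite -[ltRHS]sqrtr1 ltr_sqrt.
have h : (fun n => (1 - p)^-1 * p ^+ n) @ \oo --> (0 : R).
  rewrite -[X in _ --> X](mulr0 (1 - p)^-1); apply: cvgM; first exact: cvg_cst.
  by apply: cvg_expr; rewrite ger0_norm.
apply: (squeeze_cvgr _ (cvg_cst 0) h); near=> n.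
rewrite mulr_ge0 ?exprn_ge0 //= qE -exprM mulnC mulnC mulSn mul1n exprD mulrA.
rewrite ler_wpM2r ?exprn_ge0 //.
apply: le_trans (geometric_sum_le n (_ : 0 <= p < 1)); last by rewrite p0.
rewrite -[X in X%:R]card_ord -sum1_card natr_sum mulr_suml ler_sum // => i _.
by rewrite mul1r ler_wiXn2l ?p0 ?ltW //; exact: ltnW (ltn_ord i).
Unshelve. all: by end_near. Qed.

(** Applied to sums of absolute values: the block of terms from N / 2 to N becomes negligible, as
    needed for Cauchy products. *)
Lemma cvg_sub_half (u : nat -> R) (l : R) : u @ \oo --> l ->
  (fun N => u N - u N./2) @ \oo --> (0 : R).
Proof.
move=> ul; rewrite -(subrr l); apply: cvgB => //.
apply/cvgrPdist_lt => e e0; move/cvgrPdist_lt : ul => /(_ _ e0)[n0 _ h].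
exists (n0.*2)%N => // N /= hN; apply: h => /=.
by rewrite -(doubleK n0) half_leq.
Qed.

End RealSums.

(** * Cauchy products *)

Section Convolution.
Variable K : pzRingType.
Implicit Types a b : nat -> K.

Definition conv a b : nat -> K := fun n => \sum_(i < n.+1) a i * b (n - i)%N.

Lemma conv_sum a b N :
  \sum_(n < N) conv a b n = \sum_(i < N) a i * \sum_(j < N - i) b j.
Proof.
transitivity (\sum_(0 <= n < N) \sum_(0 <= i < N | (i <= n)%N) a i * b (n - i)%N).
  rewrite big_mkord; apply: eq_bigr => n _.
  by rewrite /conv -(big_mkord xpredT (fun i => a i * b (n - i)%N))
    (big_nat_widen _ _ N) // ltn_ord.
rewrite (exchange_big_dep_nat xpredT) //= big_mkord; apply: eq_bigr => i _.
rewrite mulr_sumr.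
transitivity (\sum_(i <= n < N) a i * b (n - i)%N).
  by rewrite (big_nat_widenl i 0).
rewrite -[X in index_iota X]add0n big_addn big_mkord; apply: eq_bigr => j _.
by rewrite addnK.
Qed.

End Convolution.

Section PowerSeries.
Variable R : realType.
Local Notation C := R[i].
Implicit Types (a b c : nat -> C) (t x y h : C) (M s : R).

Definition abs_bounded a := exists S : R, forall N, \sum_(n < N) normc (a n) <= S.

Lemma abs_boundedP a : abs_bounded a ->
  exists S : R, [/\ 0 <= S, forall N, \sum_(n < N) normc (a n) <= S &
    exists l : R, (fun N => \sum_(n < N) normc (a n)) @ \oo --> l].
Proof.
move=> [S hS]; exists S; split => //; first by have := hS 0%N; rewrite big_ord0.
suff : cvgn (fun N => \sum_(n < N) normc (a n)) by exists (limn (fun N => \sum_(n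
  < N) normc (a n))).
apply: nondecreasing_is_cvgn; last by exists S => _ [N _ <-].
apply/nondecreasing_seqP => N.
by rewrite big_ord_recr /= lerDl normc_ge0.
Qed.

Lemma normc_conv a b n :
  normc (conv a b n) <= conv (normc \o a) (normc \o b) n.
Proof.
rewrite (le_trans (normc_sum _ _ _)) //; apply: ler_sum => i _.
by rewrite Normc.normcM.
Qed.

Lemma abs_bounded_conv a b : abs_bounded a -> abs_bounded b ->
  abs_bounded (conv a b).
Proof.
move=> /abs_boundedP[S [S0 hS _]] /abs_boundedP[T [T0 hT _]].
exists (S * T) => N.
apply: (@le_trans _ _ (\sum_(n < N) conv (normc \o a) (normc \o b) n)).
  by apply: ler_sum => n _; exact: normc_conv.
rewrite conv_sum (@le_trans _ _ (\sum_(i < N) normc (a i) * T)) //.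
  by apply: ler_sum => i _; rewrite ler_wpM2l ?normc_ge0.
by rewrite -mulr_suml ler_wpM2r.
Qed.

Definition psum a N : C := \sum_(n < N) a n.

Lemma psumS a N : psum a N.+1 = psum a N + a N.
Proof. by rewrite /psum big_ord_recr. Qed.

(** The error is the sum over i < N of a_i times the difference of the partial sums of b up to N - i
    and up to N. For i < N / 2 this difference is a tail of b beyond N / 2; for i >= N / 2 it is
    bounded by [T], and the a_i form a tail of a. *)
Lemma cvg_conv a b x y : abs_bounded a -> abs_bounded b ->
  cvgC (psum a) x -> cvgC (psum b) y -> cvgC (psum (conv a b)) (x * y).
Proof.
move=> /abs_boundedP[S [S0 hS [l Al]]] /abs_boundedP[T [T0 hT [k Bk]]] ax b_y.
have half_le N : (N./2 <= N)%N.
  by rewrite -{2}(odd_double_half N) -addnn addnA leq_addl.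
pose A N := \sum_(n < N) normc (a n); pose B N := \sum_(n < N) normc (b n).
have A_mono N N' : (N <= N')%N -> A N <= A N'.
  move=> hN; rewrite /A -!(big_mkord xpredT (fun n => normc (a n))).
  by rewrite (big_cat_nat (leq0n _) hN) //= lerDl sumr_ge0 // => *;
    exact: normc_ge0.
have B_mono N N' : (N <= N')%N -> B N <= B N'.
  move=> hN; rewrite /B -!(big_mkord xpredT (fun n => normc (b n))).
  by rewrite (big_cat_nat (leq0n _) hN) //= lerDl sumr_ge0 // => *;
    exact: normc_ge0.
have B_diff N N' : (N <= N')%N ->
    normc (\sum_(j < N') b j - \sum_(j < N) b j) <= B N' - B N.
  move=> hN; rewrite /B -!(big_mkord xpredT (fun n => normc (b n))).
  rewrite -!(big_mkord xpredT b) (big_cat_nat (leq0n _) hN) //= addrAC subrr add0r.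
  by rewrite (big_cat_nat (leq0n _) hN) //= addrAC subrr add0r normc_sum.
have bound N : normc (psum (conv a b) N - psum a N * psum b N) <=
    S * (B N - B N./2) + T * (A N - A N./2).
  rewrite /psum conv_sum mulr_suml -sumrB.
  apply: le_trans (normc_sum _ _ _) _.
  apply: (@le_trans _ _ (\sum_(i < N) (normc (a i) * (B N - B N./2) +
      (if (N./2 <= i)%N then normc (a i) * T else 0)))); last first.
    rewrite big_split /= -mulr_suml lerD //.
      by rewrite ler_wpM2r ?subr_ge0 ?B_mono ?hS.
    rewrite -big_mkcond /= -mulr_suml mulrC ler_wpM2l // lerBrDl /A.
    rewrite -!(big_mkord xpredT (fun n => normc (a n))) -(big_mkord (fun i =>
      N./2 <= i)%N (fun n => normc (a n))).
    have hN := half_le N.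
    by rewrite [leRHS](big_cat_nat (leq0n _) hN) //= lerD2l
      [leRHS](big_nat_widenl _ 0%N).
  apply: ler_sum => i _; rewrite -mulrBr Normc.normcM normc_distC.
  have hi : (N - i <= N)%N by exact: leq_subr.
  case: ifPn => hNi.
    rewrite -mulrDr ler_wpM2l ?normc_ge0 // (le_trans (B_diff _ _ hi)) //.
    rewrite (@le_trans _ _ T) //.
      by rewrite lerBlDr (le_trans (hT N)) // lerDl sumr_ge0 // => *;
        exact: normc_ge0.
    by rewrite lerDr subr_ge0 B_mono.
  rewrite addr0 ler_wpM2l ?normc_ge0 // (le_trans (B_diff _ _ hi)) //.
  rewrite lerD2l lerN2 B_mono //; rewrite -ltnNge in hNi.
  rewrite leq_subRL; last exact: ltnW.
  by rewrite (leq_trans (leq_add (ltnW hNi) (leqnn _))) // addnn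
    -{2}(odd_double_half N) leq_addl.
have d0 : cvgC (fun N => psum (conv a b) N - psum a N * psum b N) 0.
  apply: (cvgC_bound (v := fun N => S * (B N - B N./2) + T * (A N - A N./2))).
    by move=> N; rewrite subr0.
  rewrite -[X in _ --> X]addr0 -[X in _ --> X + _](mulr0 S) -[X in _ --> _ +
    X](mulr0 T).
  by apply: cvgD; apply: cvgM; [exact: cvg_cst|exact: cvg_sub_half Bk|exact:
    cvg_cst|exact: cvg_sub_half Al].
have := cvgCD d0 (cvgCM ax b_y); rewrite add0r; congr cvgC.
by apply/funext => N; rewrite subrK.
Qed.

Definition pterm a t : nat -> C := fun n => a n * t ^+ n.

(** Absolute convergence is included so that the notion is stable under products. *)
Definition hasps a t y := abs_bounded (pterm a t) /\ cvgC (psum (pterm a t)) y.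

(** The sum of the series, and 0 by convention where it diverges. *)
Definition psv a t : C := xget 0 [set y | cvgC (psum (pterm a t)) y].

(** [s] is an inverse radius: the series converges where s |t| < 1. *)
Definition pbound M s a := forall n, normc (a n) <= M * s ^+ n.

Lemma cvg_psv a t y : cvgC (psum (pterm a t)) y -> psv a t = y.
Proof. by move=> h; apply: xget_unique => // z hz; apply: cvgC_uniq hz h. Qed.

Lemma hasps_psv a t y : hasps a t y -> psv a t = y.
Proof. by move=> [_]; exact: cvg_psv. Qed.

Lemma hasps_uniq a t x y : hasps a t x -> hasps a t y -> x = y.
Proof. by move=> [_ hx] [_]; exact: cvgC_uniq. Qed.

Lemma hasps_zero t : hasps (fun=> 0) t 0.
Proof.
have e N : psum (pterm (fun=> 0) t) N = 0.
  by rewrite /psum big1 // => i _; rewrite /pterm mul0r.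
split; last by rewrite (funext e); exact: cvgC_cst.
by exists 0 => N; rewrite big1 // => i _; rewrite /pterm mul0r Normc.normc0.
Qed.

Lemma hasps_add a b t x y : hasps a t x -> hasps b t y ->
  hasps (fun n => a n + b n) t (x + y).
Proof.
move=> [[S hS] hx] [[T hT] hy]; split.
  exists (S + T) => N; apply: le_trans (lerD (hS N) (hT N)).
  by rewrite -big_split ler_sum // => i _; rewrite /pterm mulrDl normcD.
have := cvgCD hx hy; congr cvgC; apply/funext => N; rewrite /psum -big_split /=.
by apply: eq_bigr => i _; rewrite /pterm mulrDl.
Qed.

Lemma hasps_sub a b t x y : hasps a t x -> hasps b t y ->
  hasps (fun n => a n - b n) t (x - y).
Proof.
move=> ha [[T hT] hy]; apply: hasps_add ha _; split.
  exists T => N; apply: le_trans (hT N); rewrite ler_sum // => i _.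
  by rewrite /pterm mulNr normcN.
have := cvgCZ (-1) hy; rewrite mulN1r; congr cvgC; apply/funext => N.
by rewrite mulN1r /psum -sumrN; apply: eq_bigr => i _; rewrite /pterm mulNr.
Qed.

Lemma hasps_sum (I : Type) (r : seq I) (P : pred I) (a : I -> nat -> C) t
    (y : I -> C) : (forall i, P i -> hasps (a i) t (y i)) ->
  hasps (fun n => \sum_(i <- r | P i) a i n) t (\sum_(i <- r | P i) y i).
Proof.
move=> h; elim: r => [|i r IH].
  rewrite (_ : (fun _ => _) = fun=> 0) ?big_nil; first exact: hasps_zero.
  by apply/funext => n; rewrite big_nil.
rewrite big_cons (_ : (fun _ => _) = fun n => if P i then a i n +
  \sum_(j <- r | P j) a j n else \sum_(j <- r | P j) a j n); last first.
  by apply/funext => n; rewrite big_cons.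
case: ifPn => Pi; last exact: IH.
exact: (hasps_add (h i Pi) IH).
Qed.

Lemma hasps_mul a b t x y : hasps a t x -> hasps b t y ->
  hasps (conv a b) t (x * y).
Proof.
move=> [Sa hx] [Sb hy].
have e : conv (pterm a t) (pterm b t) = pterm (conv a b) t.
  apply/funext => n; rewrite /pterm /conv mulr_suml; apply: eq_bigr => i _.
  by rewrite mulrACA -exprD subnKC // -ltnS.
by split; rewrite -e; [exact: abs_bounded_conv | exact: cvg_conv].
Qed.

Lemma hasps_shift a t y : hasps (fun n => a n.+1) t y ->
  hasps a t (a 0%N + t * y).
Proof.
move=> [[S hS] hy]; split.
  exists (normc (a 0%N) + normc t * S) => -[|N].
    by rewrite big_ord0 addr_ge0 ?mulr_ge0 ?normc_ge0 // (le_trans _ (hS 0%N)) //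
      big_ord0.
  rewrite big_ord_recl {1}/pterm expr0 mulr1 lerD2l.
  apply: le_trans (ler_wpM2l (normc_ge0 t) (hS N)).
  by rewrite mulr_sumr ler_sum // => i _; rewrite -Normc.normcM /pterm exprS mulrCA.
apply/cvgC_shiftS; have := cvgCD (cvgC_cst (a 0%N)) (cvgCZ t hy); congr cvgC.
apply/funext => N; rewrite /psum big_ord_recl {2}/pterm expr0 mulr1.
congr (_ + _); rewrite mulr_sumr; apply: eq_bigr => i _.
by rewrite /pterm exprS mulrCA.
Qed.

Lemma hasps_cst (c t : C) : hasps (fun n => if n is 0 then c else 0) t c.
Proof.
have := hasps_shift (a := fun n => if n is 0 then c else 0) (hasps_zero t).
by rewrite mulr0 addr0.
Qed.

Lemma pbound_ge0 M s a : pbound M s a -> 0 <= M.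
Proof. by move=> /(_ 0%N); rewrite mulr1; apply: le_trans; exact: normc_ge0. Qed.

Lemma pbound_shift M s a k : pbound M s a ->
  pbound (M * s ^+ k) s (fun n => a (n + k)%N).
Proof. by move=> h n; rewrite -mulrA -exprD addnC; apply: h. Qed.

Lemma pbound_hasps M s a t : 0 <= s -> s * normc t < 1 -> pbound M s a ->
  hasps a t (psv a t) /\ normc (psv a t) <= M / (1 - s * normc t).
Proof.
move=> s0 st h.
have bnd N : \sum_(n < N) normc (pterm a t n) <= M / (1 - s * normc t).
  apply: le_trans (_ : \sum_(n < N) M * (s * normc t) ^+ n <= _).
    apply: ler_sum => n _; rewrite Normc.normcM normcX exprMn mulrA.
    by rewrite ler_wpM2r ?exprn_ge0 ?normc_ge0.
  rewrite -mulr_sumr ler_wpM2l ?(pbound_ge0 h) //.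
  by apply: geometric_sum_le; rewrite st mulr_ge0 ?normc_ge0.
have [l hl nl] := abs_cvgC bnd.
rewrite (cvg_psv hl); split => //; split => //.
by exists (M / (1 - s * normc t)).
Qed.

Lemma psv0 M s a : 0 <= s -> pbound M s a -> psv a 0 = a 0%N.
Proof.
move=> s0 h; have s1 : s * normc (0 : C) < 1 by rewrite Normc.normc0 mulr0.
have [h1 _] := pbound_hasps s0 s1 (pbound_shift 1%N h).
have -> : psv a 0 = a 0%N + 0 * psv (fun n => a (n + 1)%N) 0; last first.
  by rewrite mul0r addr0.
by apply: hasps_psv; apply: hasps_shift; under eq_fun do rewrite -addn1.
Qed.

(* The quotient of the power series a by t - t0. *)
Definition psquot a t0 : nat -> C := fun k => psv (fun n => a (n + k.+1)%N) t0.

(** * Division by t - t0 inside the disc of convergence *)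

Section Quotient.
Variables (M s : R) (a : nat -> C) (t0 : C).
Hypotheses (s0 : 0 <= s) (st0 : s * normc t0 < 1) (ab : pbound M s a).

Let q := s / (1 - s * normc t0).

(** Each coefficient is a tail of a geometrically bounded series. The division costs a factor [q]
    but keeps [s], so it can be iterated on the same disc. *)
Lemma pbound_psquot : pbound (M * q) s (psquot a t0).
Proof.
move=> k; have [_ h] := pbound_hasps s0 st0 (pbound_shift k.+1 ab).
by rewrite (le_trans h) // /q exprS le_eqVlt; apply/orP; left; apply/eqP; ring.
Qed.

Lemma psquotS k : psquot a t0 k = a k.+1 + t0 * psquot a t0 k.+1.
Proof.
apply: hasps_psv; rewrite -[in a k.+1](add0n k.+1).
apply: (hasps_shift (a := fun n => a (n + k.+1)%N)).
have [h _] := pbound_hasps s0 st0 (pbound_shift k.+2 ab).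
rewrite (_ : (fun n => a (n.+1 + k.+1)%N) = (fun n => a (n + k.+2)%N)) //.
by apply/funext => n; rewrite addSnnS.
Qed.

Lemma psv_psquot0 : psv a t0 = a 0%N + t0 * psquot a t0 0.
Proof.
apply: hasps_psv; apply: (hasps_shift (a := a)).
have [h _] := pbound_hasps s0 st0 (pbound_shift 1%N ab).
by under eq_fun do rewrite -addn1.
Qed.

Lemma cvg_pterm0 b t y : cvgC (psum (pterm b t)) y -> cvgC (pterm b t) 0.
Proof.
move=> h; have := cvgCB ((cvgC_shiftS _ _).2 h) h; rewrite subrr; congr cvgC.
by apply/funext => n; rewrite /psum big_ord_recr /= addrAC subrr add0r.
Qed.

Lemma psv_psquot t : s * normc t < 1 ->
  psv a t = psv a t0 + (t - t0) * psv (psquot a t0) t.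
Proof.
move=> st.
have [[_ ha] _] := pbound_hasps s0 st ab.
have [[_ hq] _] := pbound_hasps s0 st pbound_psquot.
have hq' := cvgCZ t (cvg_pterm0 hq).
set b := psquot a t0 in hq hq' *.
(* The recursion [psquotS] makes the product telescope; the remaining term tends to 0 by [hq']. *)
have key N : (t - t0) * psum (pterm b t) N.+1 =
    psum (pterm a t) N.+1 - psv a t0 + t * pterm b t N.
  elim: N => [|N IH].
    by rewrite /psum !big_ord1 /pterm psv_psquot0 -/b !expr0; ring.
  rewrite [psum (pterm b t) N.+2]psumS mulrDr IH [psum _ N.+2]psumS.
  by rewrite /pterm [b N]psquotS -/b !exprS; ring.
have l1 := cvgCZ (t - t0) ((cvgC_shiftS _ _).2 hq).
have l2 := cvgCD (cvgCB ((cvgC_shiftS _ _).2 ha) (cvgC_cst (psv a t0))) hq'.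
rewrite (funext key) in l1; rewrite (cvgC_uniq l1 l2).
by rewrite mulr0 addr0 addrC subrK.
Qed.

(* By Abel summation the derivative of a at t0 is the value there of the
   quotient by t - t0. *)
Lemma cvg_psderiv :
  cvgC (psum (pterm (fun n => n.+1%:R * a n.+1) t0)) (psv (psquot a t0) t0).
Proof.
set b := psquot a t0.
have [[_ hb] _] := pbound_hasps s0 st0 pbound_psquot.
have key N : psum (pterm (fun n => n.+1%:R * a n.+1) t0) N =
    psum (pterm b t0) N - N%:R * pterm b t0 N.
  elim: N => [|N IH]; first by rewrite /psum !big_ord0 mul0r subr0.
  rewrite !psumS IH.
  by rewrite /pterm [b N]psquotS -/b !exprS -natr1; ring.
rewrite (funext key) -[X in cvgC _ X]subr0; apply: cvgCB => //.
have q01 : 0 <= s * normc t0 < 1 by rewrite st0 mulr_ge0 ?normc_ge0.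
apply: (cvgC_bound (v := fun N => M * q * (N%:R * (s * normc t0) ^+ N))).
  move=> N; rewrite subr0 !Normc.normcM normcX normc_nat.
  rewrite [leRHS]mulrCA exprMn ler_wpM2l // mulrA ler_wpM2r ?exprn_ge0 ?normc_ge0
    //.
  exact: pbound_psquot.
by rewrite -[X in _ --> X](mulr0 (M * q)); apply: cvgM;
  [exact: cvg_cst|exact: cvg_natmul_expr].
Qed.

End Quotient.

(** Instead of rearranging a double series, divide by t - t0 again and again: the new coefficients
    are the values at t0 of the successive quotients [ak k]. The remainder after n steps is (t -
    t0)^n times the value of [ak n] at t, of size at most a constant times (s' |t - t0|)^n. *)
Lemma psv_reexpand M s a t0 : 0 < s -> s * normc t0 < 1 -> pbound M s a ->
  let s' := s / (1 - s * normc t0) in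
  exists2 c, pbound (M / (1 - s * normc t0)) s' c &
    forall t, s' * normc (t - t0) < 1 -> psv a t = psv c (t - t0).
Proof.
move=> s0 st0 ab s'; have s0' := ltW s0.
have d0 : 0 < 1 - s * normc t0 by rewrite subr_gt0.
have [ak [ak0 akS]] : exists ak, ak 0%N = a /\
    forall k, ak k.+1 = psquot (ak k) t0.
  by exists (fun k => iter k (psquot^~ t0) a).
have s'0 : 0 <= s' by rewrite divr_ge0 ?ltW.
have akb k : pbound (M * s' ^+ k) s (ak k).
  elim: k => [|k IH]; first by rewrite mulr1 ak0.
  by rewrite exprSr mulrA akS; apply: pbound_psquot.
exists (fun k => psv (ak k) t0).
  move=> k; have [_] := pbound_hasps s0' st0 (akb k).
  by rewrite mulrAC.
move=> t ht.
(* Since 1 / s' = 1 / s - |t0|, the new disc lies inside the old one. *)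
have st : s * normc t < 1.
  move: ht; rewrite /s' mulrAC ltr_pdivrMr // mul1r ltrBrDr -mulrDr.
  by apply: le_lt_trans; rewrite ler_pM2l // -{1}(subrK t0 t) normcD.
have key n : psv a t = psum (pterm (fun k => psv (ak k) t0) (t - t0)) n +
    (t - t0) ^+ n * psv (ak n) t.
  elim: n => [|n IH]; first by rewrite /psum big_ord0 add0r mul1r ak0.
  rewrite IH (psv_psquot s0' st0 (akb n) st) psumS /pterm exprSr akS.
  by rewrite mulrDr mulrA addrA [_ ^+ n * psv _ _]mulrC.
apply/esym/cvg_psv.
apply: (cvgC_bound (v := fun n => M / (1 - s * normc t) * (s' * normc (t - t0))
  ^+ n)).
  move=> n; rewrite normc_distC {1}(key n) addrAC subrr add0r Normc.normcM normcX.
  have [_] := pbound_hasps s0' st (akb n).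
  move/(ler_wpM2l (exprn_ge0 n (normc_ge0 (t - t0)))) => /le_trans; apply.
  by rewrite [(s' * _) ^+ n]exprMn [leLHS]mulrC (mulrAC M) mulrA.
rewrite -[X in _ --> X](mulr0 (M / (1 - s * normc t))).
apply: cvgM; first exact: cvg_cst.
by apply: cvg_expr; rewrite ger0_norm // mulr_ge0 ?normc_ge0.
Qed.

Lemma psv_shift M s a t : 0 <= s -> s * normc t < 1 -> pbound M s a ->
  psv a t = a 0%N + t * psv (fun n => a n.+1) t.
Proof.
move=> s0 st h; apply: hasps_psv; apply: hasps_shift.
have [h1 _] := pbound_hasps s0 st (pbound_shift 1%N h).
by move: h1; under eq_fun do rewrite addn1.
Qed.

Lemma pbound_shiftS M s a : pbound M s a -> pbound (M * s) s (fun n => a n.+1).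
Proof. by move=> /(pbound_shift 1); under eq_fun do rewrite addn1. Qed.

Lemma psv_near0 M s a t : 0 < s -> pbound M s a -> s * normc t <= 2^-1 ->
  normc (psv a t) <= 2 * M.
Proof.
move=> s0 ab st; have st1 : s * normc t < 1 by apply: le_lt_trans st _; lra.
have [_ /le_trans] := pbound_hasps (ltW s0) st1 ab; apply.
rewrite mulrC ler_wpM2r ?(pbound_ge0 ab) //.
by rewrite invf_ple ?posrE ?subr_gt0 //; lra.
Qed.

(** Zeros accumulating at 0 force the constant term to vanish by continuity. As these zeros are
    nonzero points, they remain zeros after division by t, and the argument repeats. *)
Lemma psv_zeros M s a : 0 < s -> pbound M s a ->
  (forall e, 0 < e -> exists t, [/\ t != 0, normc t < e & psv a t = 0]) ->
  forall n, a n = 0.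
Proof.
move=> s0 ab hz n.
have head b N : pbound N s b ->
    (forall e, 0 < e -> exists t, [/\ t != 0, normc t < e & psv b t = 0]) ->
    b 0%N = 0.
  move=> bb bz; apply/eqP; rewrite -normc_eq0 eq_le normc_ge0 andbT.
  apply/ler_addgt0Pl => e e0; rewrite addr0.
  have N0 := pbound_ge0 bb; have b'b := pbound_shiftS bb.
  have D0 : 0 < 2 * (N * s) + 1.
    by rewrite ltr_wpDl // !mulr_ge0 // ltW.
  (* The first bound on |t| makes the shifted series at most 2 N s there, the second makes |t| times
     this at most e; the 1 in the denominator covers the case N = 0. *)
  have [|t [tn0 te bt]] := bz (Num.min (s^-1 / 2) (e / (2 * (N * s) + 1))).
    by rewrite lt_min !divr_gt0 ?invr_gt0.
  move: te; rewrite lt_min => /andP[te1 te2].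
  have st2 : s * normc t <= 2^-1 by rewrite -ler_pdivlMl // ltW.
  have st : s * normc t < 1 by apply: le_lt_trans st2 _; lra.
  have := psv_shift (ltW s0) st bb; rewrite bt => /esym/eqP.
  rewrite addr_eq0 => /eqP ->; rewrite normcN Normc.normcM.
  rewrite (le_trans (ler_wpM2l (normc_ge0 t) (psv_near0 s0 b'b st2))) //.
  move: te2; rewrite ltr_pdivlMr // => /ltW; apply: le_trans.
  by rewrite ler_wpM2l ?normc_ge0 // lerDl.
elim: n M a ab hz => [|n IH] M a ab hz; first exact: head ab hz.
have a00 := head _ _ ab hz.
apply: (IH (M * s) (fun n => a n.+1)); first exact: pbound_shiftS.
move=> e e0; have e'0 : 0 < Num.min e s^-1 by rewrite lt_min e0 invr_gt0.
have [t [tn0 + at0]] := hz _ e'0; rewrite lt_min => /andP[te ts].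
exists t; split => //; move: at0.
have st : s * normc t < 1 by rewrite -ltr_pdivlMl // mulr1.
rewrite (psv_shift (ltW s0) st ab) a00 add0r.
by move/eqP; rewrite mulf_eq0 (negPf tn0) => /eqP.
Qed.

(** Abel's estimate: the terms of a convergent series are bounded. *)
Lemma cvg_pbound a t y : t != 0 -> cvgC (psum (pterm a t)) y ->
  exists M, pbound M (normc t)^-1 a.
Proof.
move=> tn0 /cvg_pterm0 h.
have : cvgn (fun n => normc (pterm a t n)).
  by apply/cvg_ex; exists (normc 0); exact: normc_cvg h.
move=> /cvg_seq_bounded/pinfty_ex_gt0[M M0 hM]; exists M => n.
have t0 : 0 < normc t by rewrite normc_gt0.
rewrite exprVn ler_pdivlMr ?exprn_gt0 // -normcX -Normc.normcM.
have := hM n I; rewrite /= ger0_norm ?normc_ge0 //.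
Qed.

(** The difference vanishes at all small positive real numbers, which accumulate at 0. *)
Lemma psv_inj M s M' s' a b e : 0 < s -> 0 < s' -> pbound M s a ->
  pbound M' s' b -> 0 < e -> (forall t, normc t < e -> psv a t = psv b t) ->
  a = b.
Proof.
move=> s0 s'0 ab bb e0 hab; pose m := Num.max s s'.
have m0 : 0 < m by rewrite lt_max s0.
have up N r c : 0 < r -> r <= m -> pbound N r c -> pbound N m c.
  move=> r0 rm h n; rewrite (le_trans (h n)) // ler_wpM2l ?(pbound_ge0 h) //.
  by apply: lerXn2r rm; rewrite nnegrE ltW.
have am := up _ _ _ s0 (_ : s <= m) ab; have bm := up _ _ _ s'0 (_ : s' <= m) bb.
have {}am : pbound M m a by apply: am; rewrite le_max lexx.
have {}bm : pbound M' m b by apply: bm; rewrite le_max lexx orbT.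
have dm : pbound (M + M') m (fun n => a n - b n).
  by move=> n; rewrite mulrDl (le_trans (normcB _ _)) // lerD.
apply/funext => n; apply/eqP; rewrite -subr_eq0; apply/eqP.
apply: (psv_zeros m0 dm) => d d0.
pose r := Num.min (Num.min d e) m^-1 / 2.
have r0 : 0 < r by rewrite divr_gt0 // !lt_min d0 e0 invr_gt0.
have : r < Num.min (Num.min d e) m^-1.
  by rewrite ltr_pdivrMr // ltr_pMr ?ltr1n // !lt_min d0 e0 invr_gt0.
rewrite !lt_min => /andP[/andP[rd re] rm].
have nr : normc (r%:C)%C = r by rewrite normc_real // ltW.
exists (r%:C)%C; rewrite nr; split => //; first by rewrite -normc_gt0 nr.
have mr : m * normc (r%:C)%C < 1 by rewrite nr -ltr_pdivlMl // mulr1.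
have [ha _] := pbound_hasps (ltW m0) mr am.
have [hb _] := pbound_hasps (ltW m0) mr bm.
apply: hasps_psv; have := hasps_sub ha hb; by rewrite hab ?subrr // nr.
Qed.

End PowerSeries.

(** * Analytic functions *)

Section Analytic.
Variable R : realType.
Local Notation C := R[i].
Implicit Types (f g : C -> C) (t x y h : C) (M s : R).

(** The same [s] governs the growth of the coefficients and the disc where [f] must equal the sum;
    enlarging [s] shrinks this disc. *)
Definition expansion f t0 (c : nat -> C) := exists M s,
  [/\ 0 < s, pbound M s c & forall t, s * normc (t - t0) < 1 -> f t = psv c (t -
    t0)].

Definition analytic_at f t0 := exists c, expansion f t0 c.

(** Convergence at the single point t0 + e / 2 already gives a geometric bound on the
    coefficients. *)
Lemma analytic_on_at (U : set R[i]^o) (f : R[i]^o -> R[i]^o) t0 :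
  analytic_on U f -> U t0 -> analytic_at f t0.
Proof.
move=> fU /fU[c /nearcP[e e0 h]].
have hc t : normc (t - t0) < e -> cvgC (psum (pterm c (t - t0))) (f t).
  move=> /h /cvgCE; congr cvgC; apply/funext => N.
  by rewrite /psum /series /= big_mkord.
pose r : C := ((e / 2)%:C)%C.
have r0 : 0 < e / 2 by rewrite divr_gt0.
have nr : normc r = e / 2 by rewrite normc_real // ltW.
have [] := @cvg_pbound _ c r (f (t0 + r)).
- by rewrite -normc_gt0 nr.
- have := hc (t0 + r); rewrite addrAC subrr add0r; apply; rewrite nr; lra.
move=> M hM; exists c, M, (normc r)^-1; split => //.
  by rewrite invr_gt0 nr.
move=> t; rewrite nr ltr_pdivrMl // mulr1 => ht.
by apply/esym/cvg_psv/hc/(lt_trans ht); lra.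
Qed.

Lemma expansion_near f g t0 c (e : R) : 0 < e ->
  (forall t, normc (t - t0) < e -> f t = g t) -> expansion f t0 c ->
  expansion g t0 c.
Proof.
move=> e0 fg [M [s [s0 cb h]]].
exists M, (Num.max s e^-1); split.
- by rewrite lt_max s0.
- move=> n; rewrite (le_trans (cb n)) // ler_wpM2l ?(pbound_ge0 cb) //.
  by apply: lerXn2r; rewrite ?nnegrE ?le_max ?lexx ?(ltW s0).
- move=> t ht; rewrite -fg ?h //.
    by apply: le_lt_trans ht; rewrite ler_wpM2r ?normc_ge0 // le_max lexx.
  rewrite -[ltRHS]mulr1 -ltr_pdivrMl //; apply: le_lt_trans ht.
  by rewrite ler_wpM2r ?normc_ge0 // le_max lexx orbT.
Qed.

Lemma expansion_uniq f t0 c c' : expansion f t0 c -> expansion f t0 c' -> c = c'.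
Proof.
move=> [M [s [s0 cb h]]] [M' [s' [s'0 c'b h']]].
apply: (psv_inj s0 s'0 cb c'b (e := Num.min s^-1 s'^-1)).
  by rewrite lt_min !invr_gt0 s0.
move=> t; rewrite lt_min => /andP[h1 h2].
have e : t0 + t - t0 = t by rewrite addrAC subrr add0r.
have := h (t0 + t); have := h' (t0 + t); rewrite e => -> //; first move=> -> //.
  by rewrite -ltr_pdivlMl // mulr1.
by rewrite -ltr_pdivlMl // mulr1.
Qed.

Lemma expansion_hasps f t0 c : expansion f t0 c ->
  exists2 e : R, 0 < e & forall t, normc (t - t0) < e -> hasps c (t - t0) (f t).
Proof.
move=> [M [s [s0 cb h]]]; exists s^-1; first by rewrite invr_gt0.
move=> t ht; have st : s * normc (t - t0) < 1 by rewrite -ltr_pdivlMl // mulr1.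
by rewrite h //; have [] := pbound_hasps (ltW s0) st cb.
Qed.

Lemma hasps_expansion f t0 c (e : R) : 0 < e ->
  (forall t, normc (t - t0) < e -> hasps c (t - t0) (f t)) -> expansion f t0 c.
Proof.
move=> e0 h; pose r : C := ((e / 2)%:C)%C.
have r0 : 0 < e / 2 by rewrite divr_gt0.
have nr : normc r = e / 2 by rewrite normc_real // ltW.
have [] := @cvg_pbound _ c r (f (t0 + r)).
- by rewrite -normc_gt0 nr.
- have := h (t0 + r); rewrite addrAC subrr add0r => -[]//; rewrite nr; lra.
move=> M hM; exists M, (normc r)^-1; split => //.
  by rewrite invr_gt0 nr.
move=> t; rewrite nr ltr_pdivrMl // mulr1 => ht.
by apply/esym/hasps_psv/h/(lt_trans ht); lra.
Qed.

Lemma expansion_at f t0 c : expansion f t0 c -> f t0 = c 0%N.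
Proof.
move=> [M [s [s0 cb h]]]; rewrite h ?subrr ?Normc.normc0 ?mulr0 //.
exact: psv0 (ltW s0) cb.
Qed.

Lemma expansion_cst t0 (y : C) :
  expansion (fun=> y) t0 (fun n => if n is 0 then y else 0).
Proof. by apply: (hasps_expansion ltr01) => t _; exact: hasps_cst. Qed.

Lemma analytic_sub f g t0 : analytic_at f t0 -> analytic_at g t0 ->
  analytic_at (fun t => f t - g t) t0.
Proof.
move=> [c /expansion_hasps[e e0 hc]] [d /expansion_hasps[e' e'0 hd]].
exists (fun n => c n - d n); apply: (hasps_expansion (e := Num.min e e')).
  by rewrite lt_min e0.
by move=> t; rewrite lt_min => /andP[h1 h2]; apply: hasps_sub;
  [exact: hc|exact: hd].
Qed.

Lemma analytic_mul f g t0 : analytic_at f t0 -> analytic_at g t0 ->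
  analytic_at (fun t => f t * g t) t0.
Proof.
move=> [c /expansion_hasps[e e0 hc]] [d /expansion_hasps[e' e'0 hd]].
exists (conv c d); apply: (hasps_expansion (e := Num.min e e')).
  by rewrite lt_min e0.
by move=> t; rewrite lt_min => /andP[h1 h2]; apply: hasps_mul;
  [exact: hc|exact: hd].
Qed.

(** The geometric series of 1 / t around t0. Since c_{n+1} = - c_n / t0, its sum u satisfies t0 u =
    1 - (t - t0) u, that is, t u = 1. *)
Lemma analytic_inv t0 : t0 != 0 -> analytic_at GRing.inv t0.
Proof.
move=> t0n; pose c n : C := - (- t0^-1) ^+ n.+1.
have nt0 : 0 < normc t0 by rewrite normc_gt0.
exists c, (normc t0)^-1, (normc t0)^-1; split; first by rewrite invr_gt0.
  by move=> n; rewrite /c normcN normcX normcN Normc.normcV exprS.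
move=> t ht; apply/esym.
have cb : pbound (normc t0)^-1 (normc t0)^-1 c.
  by move=> n; rewrite /c normcN normcX normcN Normc.normcV exprS.
have i0 : 0 <= (normc t0)^-1 by rewrite invr_ge0 normc_ge0.
have := psv_shift i0 ht cb.
have [hc _] := pbound_hasps i0 ht cb.
have -> : psv (fun n => c n.+1) (t - t0) = - t0^-1 * psv c (t - t0).
  apply: hasps_psv; case: hc => [[S hS] hc]; split; last first.
    have := cvgCZ (- t0^-1) hc; congr cvgC; apply/funext => N.
    rewrite /psum mulr_sumr; apply: eq_bigr => i _.
    by rewrite /pterm /c (exprS _ i.+1) mulrA mulrN.
  exists (normc (- t0^-1) * S) => N.
  apply: le_trans (ler_wpM2l (normc_ge0 _) (hS N)).
  rewrite mulr_sumr ler_sum // => i _; rewrite -Normc.normcM.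
  by rewrite /pterm /c (exprS _ i.+1) mulrA mulrN.
set u := psv _ _; rewrite /c expr1 opprK => e.
have e1 : t0 * u = 1 - (t - t0) * u by rewrite {1}e; field.
have tu : t * u = 1 by rewrite -[t in LHS](subrK t0) mulrDl e1 addrC subrK.
have t_n0 : t != 0 by apply/eqP => t00; move: tu; rewrite t00 mul0r => /eqP;
  rewrite eq_sym oner_eq0.
by apply: (mulfI t_n0); rewrite mulfV.
Qed.

Lemma analytic_ext f g t0 (e : R) : 0 < e ->
  (forall t, normc (t - t0) < e -> f t = g t) -> analytic_at f t0 ->
  analytic_at g t0.
Proof. by move=> e0 fg [c h]; exists c; apply: expansion_near fg h. Qed.

(** The removable singularity at 0 is filled in by the first Taylor coefficient. The quotient stays
    analytic wherever f is, so the division can be iterated on a whole square. *)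
Lemma analytic_quot f : analytic_at f 0 -> exists2 g, analytic_at g 0 &
  [/\ forall t, f t = f 0 + t * g t,
     forall t0, analytic_at f t0 -> analytic_at g t0 &
     forall c, expansion f 0 c -> g 0 = c 1%N].
Proof.
move=> [c fc]; pose g t := if t == 0 then c 1%N else (f t - f 0) / t.
have fg t : f t = f 0 + t * g t.
  rewrite /g; case: eqVneq => [->|tn0]; first by rewrite mul0r addr0.
  by rewrite mulrC divfK // addrC subrK.
have g0 : expansion g 0 (fun n => c n.+1).
  have [M [s [s0 cb h]]] := fc.
  exists (M * s), s; split => //; first exact: pbound_shiftS.
  move=> t; have := h t; rewrite subr0 => + ht => /(_ ht) ft.
  rewrite /g; case: eqVneq => [->|tn0].
    by rewrite (psv0 (ltW s0) (pbound_shiftS cb)).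
  rewrite ft (psv_shift (ltW s0) ht cb) (expansion_at fc).
  by rewrite addrAC subrr add0r mulrC mulKf.
exists g; first by exists (fun n => c n.+1).
split => // [t0 ft0|d fd]; last first.
  by rewrite (expansion_uniq fd fc) (expansion_at g0).
have [->|t0n] := eqVneq t0 0; first by exists (fun n => c n.+1).
apply: (@analytic_ext (fun t => (f t - f 0) * t^-1) _ _ (normc t0)).
- by rewrite normc_gt0.
- move=> t ht; rewrite /g; case: eqVneq ht => // ->.
  by rewrite sub0r normcN ltxx.
apply: analytic_mul; last exact: analytic_inv.
by apply: analytic_sub => //; exists (fun n => if n is 0 then f 0 else 0);
  exact: expansion_cst.
Qed.

Lemma analytic_psv M s a t0 : 0 < s -> s * normc t0 < 1 -> pbound M s a ->
  analytic_at (psv a) t0.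
Proof.
move=> s0 st0 ab; have [c cb h] := psv_reexpand s0 st0 ab.
by exists c, (M / (1 - s * normc t0)), (s / (1 - s * normc t0)); split => //;
  rewrite divr_gt0 // subr_gt0.
Qed.

Lemma analytic_at_on (U : set R[i]^o) (f : R[i]^o -> R[i]^o) :
  (forall t, U t -> analytic_at f t) -> analytic_on U f.
Proof.
move=> h t0 /h[c /expansion_hasps[e e0 hc]]; exists c; apply/nearcP;
  exists e => // t /hc[_].
move=> hf; apply/cvgCE; move: hf; congr cvgC; apply/funext => N.
by rewrite /psum /series /= big_mkord.
Qed.

End Analytic.

(** * Maximum modulus and identity theorem *)

(** Both the sum and the sum of squares of 1, -1, I, -I vanish, so only the third-order remainders
    survive. *)
Lemma four_point_sum (A : comPzRingType) (I D f0 c1 c2 g1 g2 g3 g4 : A) :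
  I ^+ 2 = -1 ->
  f0 + c1 * (D * 1) + c2 * (D * 1) ^+ 2 + g1 * (D * 1) ^+ 3 +
  (f0 + c1 * (D * -1) + c2 * (D * -1) ^+ 2 + g2 * (D * -1) ^+ 3) +
  (f0 + c1 * (D * I) + c2 * (D * I) ^+ 2 + g3 * (D * I) ^+ 3) +
  (f0 + c1 * (D * - I) + c2 * (D * - I) ^+ 2 + g4 * (D * - I) ^+ 3) =
  4 * f0 + D ^+ 3 * (g1 - g2 + (g4 - g3) * I).
Proof. by move=> h; ring: h. Qed.

Section MaximumModulus.
Variable R : realType.
Local Notation C := R[i].
Implicit Types (f g : C -> C) (t x y h : C) (M r s : R).

(** Its closed balls are squares, compact as products of two segments. *)
Definition normi t : R := Num.max `|complex.Re t| `|complex.Im t|.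

Lemma normi_le t : normi t <= normc t.
Proof. by rewrite ge_max Re_le_normc Im_le_normc. Qed.

Lemma normc_le_normi t : normc t <= 2 * normi t.
Proof.
rewrite (le_trans (normc_le_ReIm t)) // mulr2n mulrDl mul1r.
by rewrite lerD // le_max lexx ?orbT.
Qed.

Lemma normiD x y : normi (x + y) <= normi x + normi y.
Proof.
rewrite ge_max !raddfD /= !(le_trans (ler_normD _ _)) // lerD // le_max lexx
  ?orbT //.
Qed.

Lemma analytic_continuous f t0 : analytic_at f t0 ->
  forall e : R, 0 < e -> exists2 d : R, 0 < d &
    forall t, normc (t - t0) < d -> normc (f t - f t0) < e.
Proof.
move=> [c fc] e e0; have := expansion_at fc; move: fc => [M [s [s0 cb h]]] ft0.
have M0 := pbound_ge0 cb.
have D0 : 0 < 2 * (M * s) + 1 by rewrite ltr_wpDl // !mulr_ge0 // ltW.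
exists (Num.min (s^-1 / 2) (e / (2 * (M * s) + 1))).
  by rewrite lt_min !divr_gt0 ?invr_gt0.
move=> t; rewrite lt_min => /andP[h1 h2].
have st2 : s * normc (t - t0) <= 2^-1 by rewrite -ler_pdivlMl // ltW.
have st : s * normc (t - t0) < 1 by apply: le_lt_trans st2 _; lra.
rewrite h // (psv_shift (ltW s0) st cb) ft0 addrAC subrr add0r Normc.normcM.
apply: le_lt_trans (ler_wpM2l (normc_ge0 _) (psv_near0 s0 (pbound_shiftS cb)
  st2)) _.
move: h2; rewrite ltr_pdivlMr //; apply: le_lt_trans.
by rewrite ler_wpM2l ?normc_ge0 // lerDl.
Qed.

(** Transports continuity to [R * R], where the extreme value theorem is applied. *)
Lemma continuous_normc_pair f (p : R * R) :
  (forall e : R, 0 < e -> exists2 d : R, 0 < d & forall t,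
    normc (t - Complex p.1 p.2) < d -> normc (f t - f (Complex p.1 p.2)) < e) ->
  {for p, continuous (fun q : R * R => normc (f (Complex q.1 q.2)))}.
Proof.
move=> h; apply/cvgrPdist_lt => e e0; have [d d0 hd] := h _ e0.
have d2 : 0 < d / 2 by rewrite divr_gt0.
exists (ball p.1 (d / 2), ball p.2 (d / 2)).
  by split; exact: nbhsx_ballx.
move=> q [/= q1 q2].
apply: (@le_lt_trans _ _ (normc (f (Complex q.1 q.2) - f (Complex p.1 p.2)))).
  rewrite ler_norml normc_distC normc_sub_ge andbT lerNl opprB.
  by rewrite normc_distC normc_sub_ge.
apply: hd; apply: le_lt_trans (normc_le_ReIm _) _ => /=.
move: q1 q2; rewrite /ball /= -!(distrC q.1) -!(distrC q.2) => q1 q2.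
by rewrite [d]splitr ltrD.
Qed.

(** The bound [K] does not depend on h, so that for small h the cubic remainder loses against a
    quadratic term. *)
Lemma third_order_expansion f t0 : analytic_at f t0 ->
  exists c1 c2 K, exists2 d : R, 0 < d & forall h, normc h < d ->
    exists2 g, normc g <= K &
      f (t0 + h) = f t0 + c1 * h + c2 * h ^+ 2 + g * h ^+ 3.
Proof.
move=> [c fc]; have ft0 := expansion_at fc; move: fc => [M [s [s0 cb hf]]].
exists (c 1%N), (c 2%N), (2 * (M * s * s * s)), (s^-1 / 2).
  by rewrite divr_gt0 // invr_gt0.
move=> h hh.
have st2 : s * normc h <= 2^-1 by rewrite -ler_pdivlMl // ltW.
have st : s * normc h < 1 by apply: le_lt_trans st2 _; lra.
have e : t0 + h - t0 = h by rewrite addrAC subrr add0r.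
have b1 := pbound_shiftS cb; have b2 := pbound_shiftS b1;
  have b3 := pbound_shiftS b2.
exists (psv (fun n => c n.+3) h); first exact: psv_near0 b3 st2.
have := hf (t0 + h); rewrite e => -> //.
rewrite (psv_shift (ltW s0) st cb) (psv_shift (ltW s0) st b1) (psv_shift (ltW s0)
  st b2).
by rewrite ft0; ring.
Qed.

(* If |f| + e |t|^2 were maximal at an interior point t0, compare with its
   average over t0 + d, t0 + id, t0 - d, t0 - id: the terms of order 1 and 2
   of f cancel, whereas e |t|^2 contributes e d^2. *)
Lemma maximum_modulus f r M : 0 < r ->
  (forall t, normi t <= r -> analytic_at f t) ->
  (forall t, normi t = r -> normc (f t) <= M) ->
  forall t, normi t <= r -> normc (f t) <= M.
Proof.
move=> r0 fan fM t1 t1r; rewrite leNgt; apply/negP => Mt1.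
(* On the boundary |t| is at most 2 r, so the perturbation e |t|^2 is at most half of |f(t1)| - M
   there and cannot move the maximum to the boundary. *)
pose e := (normc (f t1) - M) / (8 * r ^+ 2).
have e0 : 0 < e by rewrite divr_gt0 ?subr_gt0 // mulr_gt0 // exprn_gt0.
pose F t := normc (f t) + e * normc t ^+ 2.
pose A : set (R * R) := `[- r, r] `*` `[- r, r].
have AP p : A p <-> normi (Complex p.1 p.2) <= r.
  by rewrite /A /= !in_itv /= /normi ge_max !ler_norml; split => [[-> ->]|/andP[]].
have cA : compact A by apply: compact_setX; exact: segment_compact.
have A0 : A !=set0.
  exists (0, 0); apply/AP; rewrite /normi /= normr0 maxxx; exact: ltW.
have cF : {within A, continuous (fun p : R * R => F (Complex p.1 p.2))}.
  apply: continuous_in_subspaceT => p /set_mem/AP hp.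
  apply: cvgD; first exact/continuous_normc_pair/analytic_continuous/fan.
  apply: cvgM; first exact: cvg_cst.
  have h : {for p, continuous (fun q : R * R => normc (Complex q.1 q.2))}.
    by apply: (@continuous_normc_pair id) => d d0; exists d.
  by rewrite /GRing.exp /=; apply: cvgM.
have [[a b] /set_mem/AP /= t0r Fmax] := compact_EVT_max A0 cA cF.
set t0 := Complex a b in t0r Fmax.
have {}Fmax t : normi t <= r -> F t <= F t0.
  by case: t => x y hxy; apply: (Fmax (x, y)); apply/mem_set/AP.
have t0_lt : normi t0 < r.
  rewrite lt_neqAle t0r andbT; apply/eqP => t0E.
  have := Fmax t1 t1r; rewrite leNgt => /negP; apply.
  rewrite /F; apply: (@le_lt_trans _ _ (M + e * (2 * r) ^+ 2)).
    apply: lerD; first exact: fM.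
    rewrite ler_wpM2l ?(ltW e0) //; apply: lerXn2r.
    - by rewrite nnegrE normc_ge0.
    - by rewrite nnegrE mulr_ge0 // ltW.
    - by rewrite -t0E normc_le_normi.
  apply: (@lt_le_trans _ _ (normc (f t1))); last first.
    by rewrite lerDl mulr_ge0 ?exprn_ge0 ?normc_ge0 // ltW.
  rewrite -ltrBrDl /e exprMn.
  have -> : (normc (f t1) - M) / (8 * r ^+ 2) * (2 ^+ 2 * r ^+ 2) = (normc (f t1)
    - M) / 2.
    by field; rewrite gt_eqF.
  rewrite ltr_pdivrMr // ltr_pMr ?ltr1n // subr_gt0 //.
have [c1 [c2 [K [d d0 fexp]]]] := third_order_expansion (fan _ t0r).
have K0 : 0 <= K.
  have [|g /(le_trans (normc_ge0 _))//] := fexp 0.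
  by rewrite Normc.normc0.
(* The three bounds keep the four points in the range of the expansion, keep them in the square, and
   make [K * dd] smaller than [e]. *)
pose dd := Num.min (Num.min (d / 2) (r - normi t0)) (e / (K + 1)).
have K1 : 0 < K + 1 by rewrite ltr_wpDl.
have dd0 : 0 < dd by rewrite !lt_min subr_gt0 t0_lt (divr_gt0 d0) // (divr_gt0 e0).
have [dd1 dd2 dd3] : [/\ dd <= d / 2, dd <= r - normi t0 & dd <= e / (K + 1)].
  by rewrite /dd !ge_min !lexx ?orbT.
have near_t0 z : normc z = 1 -> exists2 g, normc g <= K &
   f (t0 + (dd%:C)%C * z) = f t0 + c1 * ((dd%:C)%C * z) + c2 * ((dd%:C)%C * z) ^+ 2
     + g * ((dd%:C)%C * z) ^+ 3 /\ F (t0 + (dd%:C)%C * z) <= F t0.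
  move=> z1; have nz : normc ((dd%:C)%C * z) = dd.
    by rewrite Normc.normcM z1 mulr1 normc_real // ltW.
  have [|g gK gE] := fexp ((dd%:C)%C * z); first by rewrite nz; lra.
  exists g => //; split => //; apply: Fmax.
  rewrite (le_trans (normiD _ _)) // -lerBrDl (le_trans (normi_le _)) // nz //.
have n1 : normc (1 : C) = 1 := Normc.normc1 _.
have ni : normc ('i%C : C) = 1 by rewrite /= expr0n /= add0r expr1n sqrtr1.
have [g1 g1K [f1 F1]] := near_t0 1 n1.
have [g2 g2K [f2 F2]] := near_t0 (-1) (etrans (normcN _) n1).
have [g3 g3K [f3 F3]] := near_t0 'i%C ni.
have [g4 g4K [f4 F4]] := near_t0 (- 'i%C) (etrans (normcN _) ni).
pose D : C := (dd%:C)%C.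
have i2 := sqr_i R.
have sumf : f (t0 + D * 1) + f (t0 + D * (-1)) + f (t0 + D * 'i%C) + f (t0 + D *
  - 'i%C)
   = 4 * f t0 + D ^+ 3 * (g1 - g2 + (g4 - g3) * 'i%C).
  by rewrite f1 f2 f3 f4; exact: four_point_sum.
have sqn (x y : R) : normc (Complex x y) ^+ 2 = x ^+ 2 + y ^+ 2.
  by rewrite sqr_sqrtr // addr_ge0 ?sqr_ge0.
have D1 : t0 + D * 1 = Complex (a + dd) b by rewrite mulr1; apply/eqP;
  rewrite eq_complex /= addr0 !eqxx.
have D2 : t0 + D * (-1) = Complex (a - dd) b.
  by rewrite mulrN1; apply/eqP; rewrite eq_complex /= oppr0 addr0 !eqxx.
have D3 : t0 + D * 'i%C = Complex a (b + dd).
  by apply/eqP; rewrite eq_complex /= !mulr0 !mul0r mulr1 subr0 !addr0 !eqxx.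
have D4 : t0 + D * - 'i%C = Complex a (b - dd).
  by rewrite mulrN; apply/eqP; rewrite eq_complex /= !mulr0 !mul0r mulr1 subr0
    oppr0 !addr0 !eqxx.
have f4n : 4 * normc (f t0) <= normc (f (t0 + D * 1)) + normc (f (t0 + D * (-1))) +
    normc (f (t0 + D * 'i%C)) + normc (f (t0 + D * - 'i%C)) + 4 * K * dd ^+ 3.
  rewrite -[leLHS](_ : normc (4 * f t0) = _);
    last by rewrite Normc.normcM normc_nat.
  rewrite -[4 * f t0](addrK (D ^+ 3 * (g1 - g2 + (g4 - g3) * 'i%C))) -sumf.
  rewrite (le_trans (normcB _ _)) // lerD //.
    by rewrite !(le_trans (normcD _ _)) // lerD2r !(le_trans (normcD _ _)) //
      lerD2r normcD.
  rewrite Normc.normcM normcX normc_real ?(ltW dd0) // mulrC.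
  rewrite ler_wpM2r ?exprn_ge0 ?(ltW dd0) //.
  rewrite (le_trans (normcD _ _)) // Normc.normcM ni mulr1.
  have := normcB g1 g2; have := normcB g4 g3; lra.
move: F1 F2 F3 F4 f4n; rewrite /F -/D D1 D2 D3 D4 !sqn => F1 F2 F3 F4 f4n.
have dd3' : dd * (K + 1) <= e by rewrite -ler_pdivlMr.
(* The squared moduli of the four points add up to 4 |t0|^2 + 4 dd^2, so maximality at t0 yields e
   <= K dd, against (K + 1) dd <= e. *)
have : dd ^+ 2 * e <= dd ^+ 2 * (K * dd) by move: F1 F2 F3 F4 f4n; clear; nra.
rewrite ler_pM2l ?exprn_gt0 //; move: dd3' dd0; clear; nra.
Qed.

(* Dividing by t repeatedly costs a factor 2 / r each time, because f - f 0 is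
   at most twice as large as f on the boundary of the square. *)
Lemma bounded_power_series f r M : 0 < r ->
  (forall t, normi t <= r -> analytic_at f t) ->
  (forall t, normi t <= r -> normc (f t) <= M) ->
  exists2 c, pbound M (2 / r) c &
    forall t, 2 / r * normc t < 1 -> hasps c t (f t).
Proof.
move=> r0 fan fM.
have i0 : normi 0 <= r by rewrite /normi /= normr0 maxxx ltW.
(* A total operator of division by t; its value at functions not analytic at 0 is a dummy. *)
have /choice[q qP] (g : C -> C) : exists g', analytic_at g 0 ->
    (forall t, g t = g 0 + t * g' t) /\
    (forall t0, analytic_at g t0 -> analytic_at g' t0).
  have [/analytic_quot[g' _ [h1 h2 _]]|ng] := pselect (analytic_at g 0).
    by exists g'.
  by exists g.
pose fk k := iter k q f; pose c k := fk k 0.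
have fkan k t : normi t <= r -> analytic_at (fk k) t.
  elim: k t => [|k IH] t tr; first exact: fan.
  by have [_] := qP _ (IH _ i0); apply; exact: IH.
have fkS k t : fk k t = c k + t * fk k.+1 t.
  by have [h _] := qP _ (fkan k _ i0).
have q0 : 0 < 2 / r by rewrite divr_gt0.
have fkM k t : normi t <= r -> normc (fk k t) <= M * (2 / r) ^+ k.
  elim: k t => [|k IH] t tr; first by rewrite mulr1; exact: fM.
  move: t tr; apply: maximum_modulus => // [t|t tr]; first exact: fkan.
  have rt : r <= normc t by rewrite -tr normi_le.
  have tn0 : 0 < normc t by exact: lt_le_trans rt.
  have e : normc t * normc (fk k.+1 t) <= 2 * (M * (2 / r) ^+ k).
    rewrite -Normc.normcM -(addKr (c k) (t * _)) -fkS.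
    rewrite (le_trans (normcD _ _)) // normcN mulr2n mulrDl mul1r.
    by rewrite lerD // IH // tr.
  rewrite exprS mulrCA -[leRHS]mulrA mulrCA mulrC ler_pdivlMr // mulrC.
  apply: le_trans e; rewrite ler_wpM2r // normc_ge0 //.
have cb : pbound M (2 / r) c by move=> k; exact: fkM.
exists c => // t tr.
have [hc _] := pbound_hasps (ltW q0) tr cb.
have it : normi t <= r.
  rewrite (le_trans (normi_le t)) //; move: tr; rewrite mulrAC ltr_pdivrMr // mul1r.
  by have := normc_ge0 t; lra.
rewrite (_ : f t = psv c t) //; apply/esym/cvg_psv.
(* Taylor's formula; the remainder is at most M (2 |t| / r)^n by [fkM]. *)
have key n : f t = psum (pterm c t) n + t ^+ n * fk n t.
  elim: n => [|n IH]; first by rewrite /psum big_ord0 add0r mul1r.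
  by rewrite IH psumS /pterm fkS exprSr mulrDr mulrA addrA [_ ^+ n * c n]mulrC.
apply: (cvgC_bound (v := fun n => M * (2 / r * normc t) ^+ n)).
  move=> n; rewrite normc_distC {1}(key n) addrAC subrr add0r Normc.normcM normcX.
  by rewrite exprMn mulrA mulrC ler_wpM2r ?exprn_ge0 ?normc_ge0 // fkM.
rewrite -[X in _ --> X](mulr0 M).
apply: cvgM; first exact: cvg_cst.
by apply: cvg_expr; rewrite ger0_norm // mulr_ge0 ?normc_ge0 // ltW.
Qed.

(** Connectedness of the segment from 0 to t: the parameters near whose image f vanishes identically
    form an open set, which is also closed because zeros accumulating at a point kill the expansion
    there ([psv_zeros]). *)
Lemma identity_theorem f r : (forall t, normc t < r -> analytic_at f t) ->
  (exists2 e, 0 < e & forall t, normc t < e -> f t = 0) ->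
  forall t, normc t < r -> f t = 0.
Proof.
move=> fan [e0 e00 fe0] t tr.
have [->|tn0] := eqVneq t 0; first by apply: fe0; rewrite Normc.normc0.
have nt0 : 0 < normc t by rewrite normc_gt0.
pose p (s : R) : C := (s%:C)%C * t.
have pB s s' : normc (p s - p s') = `|s - s'| * normc t.
  rewrite /p -mulrBl Normc.normcM -rmorphB; congr (_ * _).
  by apply: complexI; rewrite -normc_norm normc_def /= expr0n /= addr0 sqrtr_sqr.
pose Z : set R := [set s | exists2 e : R, 0 < e & forall z, normc (z - p s) < e
  -> f z = 0].
have Zopen : open Z.
  rewrite openE => s [e he hz]; apply/nbhs_ballP.
  exists (e / 2 / normc t) => /=; first by rewrite !divr_gt0.
  move=> s'; rewrite /ball /= ltr_pdivlMr // -pB => ss'; exists (e / 2);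
    first by rewrite divr_gt0.
  move=> z zs'; apply: hz; rewrite -(subrK (p s') z) -addrA.
  rewrite (le_lt_trans (normcD _ _)) // [ltRHS]splitr ltrD // normc_distC //.
have inr s : s \in `[0, 1] -> normc (p s) < r.
  rewrite in_itv /= => /andP[s0 s1]; rewrite /p Normc.normcM normc_real //.
  by rewrite (le_lt_trans _ tr) // ler_piMl // normc_ge0.
have Zclosed s : s \in `[0, 1] -> closure Z s -> Z s.
  move=> s01 clZ; have [c fc] := fan _ (inr _ s01).
  have [|nZs] := pselect (Z s) => //.
  have [M [d [d0 cb h]]] := fc.
  have c0 : forall n, c n = 0.
    apply: (psv_zeros d0 cb) => e he.
    pose e' := Num.min e d^-1.
    have e'0 : 0 < e' by rewrite lt_min he invr_gt0.
    have [|s' [[e1 e10 hs'] ss']] := clZ (ball s (e' / normc t)).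
      by apply: nbhsx_ballx; rewrite divr_gt0.
    move: ss'; rewrite /ball /= ltr_pdivlMr // -pB normc_distC.
    rewrite lt_min => /andP[h1 h2].
    exists (p s' - p s); split => //.
      apply/eqP => /(congr1 (fun z : C => z + p s)); rewrite subrK add0r => pp.
      by apply: nZs; exists e1 => //; rewrite -pp.
    rewrite -h; last by rewrite -ltr_pdivlMl // mulr1.
    by apply: hs'; rewrite subrr Normc.normc0.
  exists d^-1; first by rewrite invr_gt0.
  move=> z hz; rewrite h; last by rewrite -ltr_pdivlMl // mulr1.
  rewrite (_ : c = fun=> 0); last exact/funext.
  exact: hasps_psv (hasps_zero _).
have I01 : `[0, 1]%classic `&` Z = `[0 : R, 1]%classic.
  apply: (@segment_connected R 0 1).
  - exists 0; split; first by rewrite /= in_itv /= lexx ler01.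
    by exists e0 => // z; rewrite /p rmorph0 mul0r subr0; exact: fe0.
  - by exists Z.
  - exists (closure Z); first exact: closed_closure.
    apply/seteqP; split => s [s01 hs]; split => //; first exact: subset_closure.
    exact: Zclosed.
have : (`[0, 1]%classic `&` Z) (1 : R) by rewrite I01 /= in_itv /= lexx ler01.
move=> [_ [e he]]; apply; rewrite /p rmorph1 mul1r subrr Normc.normc0 //.
Qed.

End MaximumModulus.

(** * Decompositions of paths *)

Section PathLemmas.
Variable Q : quiver.
Implicit Types (u w : qpath Q) (us : seq (qpath Q)).

Lemma psrc_cat w u s : (0 < plen u)%N -> parrows w = parrows u ++ s ->
  psrc w = psrc u.
Proof.
rewrite /plen; have := walk_parrows w; have := walk_parrows u.
case: (parrows u) => // a v /= /andP[/eqP <- _] + _ e; rewrite e /=.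
by move=> /andP[/eqP <-].
Qed.

Lemma ptgt_cat w u s : (0 < plen u)%N -> parrows w = s ++ parrows u ->
  ptgt w = ptgt u.
Proof.
rewrite /plen /ptgt => + ->; rewrite map_cat last_cat.
by case: (parrows u).
Qed.

Lemma parrows_inj w u : (0 < plen u)%N -> parrows w = parrows u -> w = u.
Proof.
move=> u0 e; apply: qpath_inj => //.
by apply: (psrc_cat (s := [::])) => //; rewrite cats0.
Qed.

Lemma psrc_decomposition w u us : decompositions w (u :: us) -> psrc w = psrc u.
Proof. by move=> [_ /= /andP[u0 _] e]; rewrite (psrc_cat u0 (esym e)). Qed.

Lemma ptgt_decomposition w u us : decompositions w (rcons us u) -> ptgt w = ptgt u.
Proof.
move=> [_]; rewrite all_rcons => /andP[u0 _].
by rewrite map_rcons flatten_rcons => e; rewrite (ptgt_cat u0 (esym e)).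
Qed.

Lemma plen_decomposition w us : decompositions w us ->
  plen w = (\sum_(u <- us) plen u)%N.
Proof.
move=> [_ _ e]; rewrite /plen -e size_flatten sumnE /shape -map_comp big_map.
exact: eq_bigr.
Qed.

(** The source of w is that of its first factor, hence of the first arrow of the word, hence of b;
    the target is treated likewise with the last factor and the last arrow. *)
Lemma parallel_decomposition b p w us (a : seq (arrow Q)) :
  decompositions w us -> size a = size us -> word_path a = Some p ->
  (forall x, x \in zip a us -> parallel x.1 x.2) -> parallel b p -> parallel b w.
Proof.
move=> dw sz wp par; case: a wp sz par => // a0 a wp.
have [ps pa] : psrc p = src a0 /\ parrows p = a0 :: a.
  by move: wp; rewrite /word_path; case: insubP => // p' _ + [<-];
    rewrite /psrc /parrows => ->.
case: us dw => // u0 us dw sz par /andP[/eqP sb /eqP tb]; apply/andP; split.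
  have /andP[/eqP /= e _] := par (a0, u0) (mem_head _ _).
  by rewrite sb ps (psrc_decomposition dw) e.
move: dw par sz; rewrite lastI [in zip _ _]lastI => dw par sz.
rewrite tb (ptgt_decomposition dw) {1}/ptgt pa /= last_map.
have m : (last a0 a, last u0 us) \in
    zip (rcons (belast a0 a) (last a0 a)) (rcons (belast u0 us) (last u0 us)).
  by move: sz; rewrite size_rcons size_belast /= => -[sz];
     rewrite zip_rcons ?mem_rcons ?mem_head // !size_belast.
by case/andP: (par _ m).
Qed.

(** Organized by the first factor, with [n] as fuel. It serves as a list containing all
    decompositions over which sums can be estimated by induction. *)
Fixpoint decomposition_list n w : seq (seq (qpath Q)) :=
  if n is n'.+1 then
    [:: w] :: flatten [seq [seq ptake j w :: us
      | us <- decomposition_list n' (pdrop j w)] | j <- index_iota 1 (plen w)]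
  else [::].

Lemma mem_decomposition_list n w us : (plen w <= n)%N ->
  decompositions w us -> us \in decomposition_list n w.
Proof.
elim: n w us => [|n IH] w [|u us] wn.
- by move=> [].
- move=> [_ /= /andP[u0 _] /(congr1 size)]; rewrite size_cat; move: wn u0.
  by rewrite /plen; case: (size _) => // _; case: (size _).
- by move=> [].
move=> [_ /= /andP[u0 us0] e]; rewrite inE.
case: us us0 e => [|v us] us0 e.
  rewrite (_ : u = w) ?eqxx //; apply/esym/parrows_inj => //.
  by rewrite -e /= cats0.
apply/orP; right; apply/flatten_mapP; exists (plen u).
  rewrite mem_index_iota u0 /plen -e /= !size_cat -[ltnLHS]addn0 ltn_add2l.
  by case/andP: us0 => v0 _; rewrite (leq_trans v0) // leq_addr.
have ue : ptake (plen u) w = u.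
  by apply: parrows_inj => //; rewrite {1}/parrows /= -e /plen take_size_cat.
apply/mapP; exists (v :: us); last by rewrite ue.
apply: IH.
  rewrite plen_drop leq_subLR (leq_trans wn) // -add1n leq_add2r //.
split => //; rewrite -/([seq parrows i | i <- v :: us]).
by rewrite [RHS]/parrows /= -e /plen drop_size_cat.
Qed.

End PathLemmas.

(** * Majorants and the formal solution *)

Section Majorant.
Variable R : realType.
Implicit Types (x : R).

(* Stable under convolution up to a constant, and multiplied by at least
   1 / 4 from one term to the next. *)
Definition pwt (n : nat) : R := (n.+1%:R ^+ 2)^-1.

Lemma pwt_gt0 n : 0 < pwt n.
Proof. by rewrite invr_gt0 exprn_gt0. Qed.

Lemma pwt_ge0 n : 0 <= pwt n. Proof. exact/ltW/pwt_gt0. Qed.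

Lemma pwt_le1 n : pwt n <= 1.
Proof. by rewrite invf_le1 ?exprn_gt0 // exprn_ege1 // ler1n. Qed.

Lemma pwtS n : pwt n <= 4 * pwt n.+1.
Proof.
rewrite /pwt -ler_pdivrMl // -invfM lef_pV2 ?posrE ?mulr_gt0 ?exprn_gt0 //.
have n1 : 1 <= n.+1%:R :> R by rewrite ler1n.
by rewrite -(natr1 n.+1); nra.
Qed.

(** From n + 1 <= 2^n. It lets a plain geometric bound q^n be replaced by the weighted bound (4 q)^n
    [pwt n]. *)
Lemma expr4_pwt n : 1 <= 4 ^+ n * pwt n.
Proof.
rewrite /pwt ler_pdivlMr ?exprn_gt0 // mul1r.
have -> : 4 ^+ n = (2 ^+ n) ^+ 2 :> R by rewrite -exprM mulnC exprM;
  congr (_ ^+ n); rewrite -natrX.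
rewrite lerXn2r ?nnegrE ?exprn_ge0 // -natrX ler_nat; exact: ltn_expl.
Qed.

Lemma pwt_sum n : \sum_(i < n) pwt i <= 2.
Proof.
(* The stronger bound telescopes. *)
suff h : \sum_(i < n.+1) pwt i <= 2 - n.+1%:R^-1.
  apply: le_trans (_ : \sum_(i < n.+1) pwt i <= _).
    by rewrite big_ord_recr /= lerDl pwt_ge0.
  by rewrite (le_trans h) // gerBl invr_ge0.
elim: n => [|n IH]; first by rewrite big_ord1 /pwt expr1n invr1; lra.
rewrite big_ord_recr /= (le_trans (lerD IH (lexx _))) // /pwt.
have n0 : 0 < n.+1%:R :> R by [].
rewrite -(natr1 n.+1); move: (n.+1%:R : R) n0 => x x0.
have x1 : 0 < x + 1 by rewrite addr_gt0.
rewrite -subr_ge0 (_ : _ - _ = (x * (x + 1) ^+ 2)^-1).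
  by rewrite invr_ge0 mulr_ge0 ?exprn_ge0 // ltW.
by field; rewrite !gt_eqF.
Qed.

(** With x = i + 1 and y = n - i + 1, the identity 1 / (x y) = (1 / x + 1 / y) / (x + y) gives 1 /
    (x y)^2 <= 2 (1 / x^2 + 1 / y^2) / (n + 2)^2. Each of the two resulting sums is at most 2,
    whence the constant 8. *)
Lemma pwt_conv n : conv pwt pwt n <= 8 * pwt n.
Proof.
have key (i : 'I_n.+1) : pwt i * pwt (n - i) <=
    2 / n.+2%:R ^+ 2 * (pwt i + pwt (n - i)).
  have -> : n.+2%:R = i.+1%:R + (n - i).+1%:R :> R.
    by rewrite -natrD addSn addnS subnKC // -ltnS.
  rewrite /pwt; have : 0 < i.+1%:R :> R by []. have : 0 < (n - i).+1%:R :> R by [].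
  move: (i.+1%:R) ((n - i).+1%:R) => x y y0 x0.
  have xy0 : 0 < x + y by rewrite addr_gt0.
  rewrite -subr_ge0 (_ : _ - _ = ((x - y) / (x * y * (x + y))) ^+ 2) ?sqr_ge0 //.
  by field; rewrite !gt_eqF.
rewrite /conv (le_trans (ler_sum _ (fun i _ => key i))) // -mulr_sumr big_split /=.
have -> : \sum_(i < n.+1) pwt (n - i) = \sum_(i < n.+1) pwt i.
  rewrite [LHS](reindex_inj rev_ord_inj) /=; apply: eq_bigr => i _.
  by rewrite subSS subKn // -ltnS.
apply: le_trans (_ : 2 / n.+2%:R ^+ 2 * 4 <= _).
  rewrite ler_wpM2l ?divr_ge0 ?exprn_ge0 //.
  by have := pwt_sum n.+1; lra.
rewrite mulrAC -natrM ler_wpM2l // /pwt lef_pV2 ?posrE ?exprn_gt0 //.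
by rewrite lerXn2r ?nnegrE // ler_nat.
Qed.

(** Splitting off the first factor and using induction for the rest, the decompositions with several
    factors contribute at most 2 x^2 times the convolution of the weights, hence at most 16 x^2
    [pwt (plen w)]. The condition on x bounds this by the contribution of w itself. *)
Lemma decomposition_list_weight (Q : quiver) n (w : qpath Q) x :
  0 <= x -> 16 * x <= 1 ->
  \sum_(us <- decomposition_list n w) \prod_(u <- us) (x * pwt (plen u)) <=
    2 * (x * pwt (plen w)).
Proof.
move=> x0 x1; elim: n w => [|n IH] w.
  by rewrite big_nil mulr_ge0 // mulr_ge0 // pwt_ge0.
have weight_ge0 (us : seq (qpath Q)) : 0 <= \prod_(u <- us) (x * pwt (plen u)).
  by apply: prodr_ge0 => u _; rewrite mulr_ge0 // pwt_ge0.
rewrite /= big_cons big_seq1 big_flatten /= big_map [leRHS]mulr_natl mulr2n lerD2l.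
set m := plen w.
apply: le_trans (_ : \sum_(1 <= j < m) (x * pwt j) * (2 * (x * pwt (m - j))) <= _).
  rewrite big_nat_cond [leRHS]big_nat_cond; apply: ler_sum => j;
    rewrite andbT => /andP[j0 jm].
  rewrite big_map (eq_bigr (fun us => (x * pwt j) * \prod_(u <- us) (x * pwt
    (plen u)))).
    rewrite -mulr_sumr ler_wpM2l ?mulr_ge0 ?pwt_ge0 // -plen_drop; exact: IH.
  by move=> us _; rewrite big_cons plen_take // ltnW.
apply: le_trans (_ : 2 * x ^+ 2 * conv pwt pwt m <= _).
  rewrite /conv mulr_sumr -(big_mkord xpredT (fun j => 2 * x ^+ 2 * (pwt j * pwt
    (m - j)))).
  have [m0|m0] := posnP m.
    by rewrite m0 [leLHS]big_geq // big_nat1 !mulr_ge0 ?pwt_ge0 ?sqr_ge0.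
  rewrite big_ltn // big_nat_recr //= -[leLHS]add0r lerD //.
    by rewrite !mulr_ge0 ?pwt_ge0 ?sqr_ge0.
  rewrite -[leLHS]addr0 lerD //; last by rewrite !mulr_ge0 ?pwt_ge0 ?sqr_ge0.
  by apply: ler_sum => j _; rewrite le_eqVlt; apply/orP; left; apply/eqP; ring.
apply: le_trans (ler_wpM2l _ (pwt_conv m)) _; first by rewrite mulr_ge0 ?sqr_ge0.
by have := ler_wpM2r (mulr_ge0 x0 (pwt_ge0 m)) x1; lra.
Qed.

End Majorant.

Lemma ler_sum_subset (R : numDomainType) (I : eqType) (s s' : seq I)
    (F : I -> R) : (forall i, 0 <= F i) -> uniq s -> {subset s <= s'} ->
  \sum_(i <- s) F i <= \sum_(i <- s') F i.
Proof.
move=> F0; elim: s s' => [|x s IH] s' /=.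
  by move=> _ _; rewrite big_nil sumr_ge0.
move=> /andP[xs us] ss'; have xs' : x \in s' by rewrite ss' ?mem_head.
rewrite (perm_big _ (perm_to_rem xs')) !big_cons lerD2l IH // => y ys.
have yx : y != x by apply: contraNneq xs => <-.
by rewrite rem_mem // ss' // inE ys orbT.
Qed.

(** * The recursion for the Taylor coefficients of the solution *)

Section Recursion.
Variables (R : realType) (Q : quiver).
Local Notation C := R[i].
Local Notation coefs := (arrow Q -> qpath Q -> nat -> C).
Implicit Types (l c : coefs) (F : nat -> C) (b : arrow Q) (w u : qpath Q).

Definition cone : nat -> C := fun n => if n is 0 then 1 else 0.

Definition cprod d (F : 'I_d -> nat -> C) : nat -> C :=
  \big[@conv C/cone]_(i < d) F i.

Definition lword l b (s : seq (arrow Q)) : nat -> C :=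
  if word_path s is Some w then l b w else fun=> 0.

(* Taylor coefficients at t = 0 of the right-hand side of the system and of one
   Picard step.  In order m, a step only involves the coefficients of order less
   than m, so that m + 1 steps determine the solution. *)
Definition rhs_coef l c b w m : C :=
  \sum_(us <- fset_set (decompositions w)) \sum_(a : (size us).-tuple (arrow Q))
    conv (lword l b a)
      (cprod (fun i => c (tnth a i) (tnth (in_tuple us) i))) m.

Definition init_coef b w : C := (parrows w == [:: b])%:R.

Definition picard l c b w m : C :=
  if m is m'.+1 then rhs_coef l c b w m' / m'.+1%:R else init_coef b w.

Definition sol_coef l b w m : C :=
  iter m.+1 (picard l) (fun _ _ _ => 0) b w m.

Lemma eq_conv (a a' b b' : nat -> C) m :
  (forall i, (i <= m)%N -> a i = a' i) -> (forall i, (i <= m)%N -> b i = b' i) ->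
  conv a b m = conv a' b' m.
Proof.
move=> ha hb; apply: eq_bigr => i _.
by rewrite ha ?hb ?leq_subr // -ltnS.
Qed.

Lemma cprodS d (F : 'I_d.+1 -> nat -> C) :
  cprod F = conv (F ord0) (cprod (fun i => F (lift ord0 i))).
Proof. by rewrite /cprod big_ord_recl. Qed.

Lemma eq_cprod d (F F' : 'I_d -> nat -> C) m :
  (forall i j, (j <= m)%N -> F i j = F' i j) -> cprod F m = cprod F' m.
Proof.
elim: d F F' m => [|d IH] F F' m h; first by rewrite /cprod !big_ord0.
rewrite !cprodS; apply: eq_conv => j jm; first exact: h.
by apply: IH => i k kj; apply: h; apply: leq_trans jm.
Qed.

Lemma cprod_eq0 d (F : 'I_d -> nat -> C) m i :
  (forall j, (j <= m)%N -> F i j = 0) -> cprod F m = 0.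
Proof.
elim: d F m i => [|d IH] F m i h; first by case: i h.
rewrite cprodS /conv big1 // => k _; have km : (k <= m)%N by rewrite -ltnS.
case: (unliftP ord0 i) h => [j ->|->] h; last by rewrite h ?mul0r.
rewrite (IH _ _ j) ?mulr0 // => n nk; apply: h; rewrite (leq_trans nk) //.
exact: leq_subr.
Qed.

Lemma eq_rhs_coef l c c' b w m :
  (forall a u i, (i <= m)%N -> c a u i = c' a u i) ->
  rhs_coef l c b w m = rhs_coef l c' b w m.
Proof.
move=> h; apply: eq_bigr => us _; apply: eq_bigr => a _.
apply: eq_conv => // i im; apply: eq_cprod => k j ji.
by apply: h; apply: leq_trans im.
Qed.

Definition agree M c c' := forall b w m, (m < M)%N -> c b w m = c' b w m.

(** Integration in t raises the order by one, so a Picard step is a contraction for the order in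
    t. *)
Lemma picard_agree l M c c' : agree M c c' -> agree M.+1 (picard l c) (picard l c').
Proof.
move=> h b w [|m] //= mM; congr (_ / _); apply: eq_rhs_coef => a u i im.
by apply: h; apply: leq_ltn_trans im _.
Qed.

Lemma sol_coef_agree l M :
  agree M (sol_coef l) (iter M (picard l) (fun _ _ _ => 0)).
Proof.
have h N k : agree N (iter N (picard l) (fun _ _ _ => 0))
    (iter (N + k) (picard l) (fun _ _ _ => 0)).
  by elim: N => [|N IH]; [|exact: picard_agree].
move=> b w m mM; rewrite /sol_coef (h m.+1 (M - m.+1)%N) //.
by rewrite subnKC.
Qed.

Lemma picard_sol_coef l b w m : picard l (sol_coef l) b w m = sol_coef l b w m.
Proof.
by rewrite (@picard_agree l m _ _ (@sol_coef_agree l m) b w m).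
Qed.

Lemma sol_coef_uniq l c : (forall b w m, picard l c b w m = c b w m) ->
  forall b w m, c b w m = sol_coef l b w m.
Proof.
move=> h; suff H M : agree M c (sol_coef l) by move=> b w m; apply: (H m.+1).
elim: M => // M IH b w m mM; rewrite -h -picard_sol_coef.
exact: (@picard_agree l M _ _ IH).
Qed.

Lemma parallel_arrow b w : parrows w = [:: b] -> parallel b w.
Proof.
move=> e; have := walk_parrows w; rewrite /parallel /ptgt e /= => /andP[-> _].
by rewrite eqxx.
Qed.

(** If b and w are not parallel, then for each decomposition and each word either the word is not a
    path parallel to b, and lambda vanishes, or some letter is not parallel to its factor, by
    [parallel_decomposition], and that gamma vanishes in lower orders. *)
Lemma sol_coef_parallel l : (forall b p m, ~~ parallel b p -> l b p m = 0) ->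
  forall b w m, ~~ parallel b w -> sol_coef l b w m = 0.
Proof.
move=> hl b w m; elim/ltn_ind: m b w => -[|m] IH b w nbw;
  rewrite -picard_sol_coef /=.
  rewrite /init_coef; case: eqP => // /parallel_arrow bw.
  by rewrite bw in nbw.
rewrite /rhs_coef big_seq big1 ?mul0r // => us.
rewrite in_fset_set; last exact: finite_decompositions.
move=> /set_mem dus; apply: big1 => a _.
have lw0 : ~ (exists2 p, word_path a = Some p & parallel b p) ->
    lword l b a = fun=> 0.
  rewrite /lword; case: (word_path a) => // p h; apply/funext => j; apply: hl.
  by apply/negP => bp; apply: h; exists p.
have [[p wp bp]|/lw0 ->] := pselect (exists2 p, word_path a = Some p & parallel b
  p); last first.
  by rewrite /conv big1 // => i _; rewrite mul0r.
have [|/forallPn[i ni]] := boolP [forall i, parallel (tnth a i) (tnth (in_tuple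
  us) i)].
  move=> /forallP par; exfalso; move/negP: nbw; apply.
  apply: (parallel_decomposition dus _ wp _ bp); first by rewrite size_tuple.
  move=> [x u] xu; have [i iu] := nthP (b, w) xu.
  rewrite size_zip size_tuple minnn in iu.
  rewrite nth_zip ?size_tuple // => -[<- <-]; have := par (Ordinal iu).
  by rewrite !(tnth_nth b) !(tnth_nth w).
rewrite /conv big1 // => k _; rewrite (cprod_eq0 (i := i)) ?mulr0 // => j jk.
apply: IH => //; rewrite ltnS (leq_trans jk) // leq_subr //.
Qed.

(** Limited to orders at most [M], so that it can serve as an induction hypothesis on the order. *)
Definition gbound (al B : R) M (a : nat -> C) :=
  forall i, (i <= M)%N -> normc (a i) <= al * (B ^+ i * pwt R i).

Lemma gbound_ge0 al B M a : gbound al B M a -> 0 <= al.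
Proof.
move=> /(_ 0%N (leq0n _)); rewrite expr0 /pwt expr1n invr1 !mulr1.
by apply: le_trans; exact: normc_ge0.
Qed.

Lemma gbound_conv al be B M (a b : nat -> C) : 0 <= B -> gbound al B M a ->
  gbound be B M b ->
  gbound (8 * (al * be)) B M (conv a b).
Proof.
move=> B0 ha hb i iM; have al0 := gbound_ge0 ha; have be0 := gbound_ge0 hb.
rewrite (le_trans (normc_conv _ _ _)) //.
apply: le_trans (_ : \sum_(j < i.+1) al * be * B ^+ i * (pwt R j * pwt R (i - j))
  <= _).
  apply: ler_sum => j _; have ji : (j <= i)%N by rewrite -ltnS.
  have -> : al * be * B ^+ i * (pwt R j * pwt R (i - j)) =
    (al * (B ^+ j * pwt R j)) * (be * (B ^+ (i - j) * pwt R (i - j))).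
    by rewrite -{1}(subnKC ji) exprD; ring.
  apply: ler_pM; rewrite ?normc_ge0 //; first by apply: ha; apply: leq_trans iM.
  by apply: hb; rewrite (leq_trans (leq_subr _ _)).
rewrite -mulr_sumr; have := pwt_conv R i; rewrite /conv => h.
apply: le_trans (ler_wpM2l _ h) _; first by rewrite !mulr_ge0 ?exprn_ge0.
by rewrite le_eqVlt; apply/orP; left; apply/eqP; ring.
Qed.

Lemma gbound_cprod d (al : 'I_d -> R) B M (F : 'I_d -> nat -> C) : 0 <= B ->
  (forall i, gbound (al i) B M (F i)) ->
  gbound (8 ^+ d * \prod_(i < d) al i) B M (cprod F).
Proof.
move=> B0; elim: d al F => [|d IH] al F h.
  rewrite /cprod !big_ord0 mulr1 => -[|i] _.
    by rewrite (_ : cone 0%N = 1) // Normc.normc1 /pwt expr1n invr1 !mulr1.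
  by rewrite (_ : cone i.+1 = 0) // Normc.normc0 mul1r mulr_ge0 ?exprn_ge0 ?pwt_ge0.
rewrite cprodS big_ord_recl exprS mulrACA -mulrA [al ord0 * _]mulrC -mulrA.
rewrite [X in 8 * X](_ : _ = al ord0 * (8 ^+ d * \prod_(i < d) al (lift ord0 i))).
  by apply: gbound_conv => //; apply: IH => i.
by ring.
Qed.

Section Bound.
Variables (l : coefs) (L q : R).
Hypotheses (L1 : 1 <= L) (q0 : 0 <= q).
Hypothesis l_bound : forall b w m, normc (l b w m) <= L ^+ plen w * q ^+ m.

(* P0 makes the ratio 8 k L P0 of the sum over decompositions at most 1 / 16, A
   accounts for the initial value, and B for the coefficients of lambda and, in
   view of pwtS, for the passage from order m to m + 1. *)
Let k : R := #|arrow Q|.+1%:R.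
Let P0 : R := (128 * k * L)^-1.
Let A : R := 4 / P0.
Let B : R := 4 * q + 512 * k * L.

Let k1 : 1 <= k. Proof. by rewrite ler1n. Qed.
Let kL1 : 1 <= k * L. Proof. by rewrite mulr_ege1. Qed.
Let P0gt0 : 0 < P0.
Proof. by rewrite invr_gt0 -mulrA mulr_gt0 // (lt_le_trans ltr01). Qed.
Let Bge0 : 0 <= B.
Proof. by rewrite /B -mulrA addr_ge0 ?mulr_ge0 // (le_trans ler01). Qed.
Let Agt0 : 0 < A. Proof. by rewrite divr_gt0. Qed.

Lemma gbound_lword b (s : seq (arrow Q)) M :
  gbound (L ^+ size s) B M (lword l b s).
Proof.
have L0 : 0 <= L := le_trans ler01 L1.
have hB i : q ^+ i <= B ^+ i * pwt R i.
  apply: le_trans (_ : (4 * q) ^+ i * pwt R i <= _).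
    by rewrite exprMn mulrAC ler_peMl ?exprn_ge0 ?expr4_pwt.
  rewrite ler_wpM2r ?pwt_ge0 //; apply: lerXn2r; rewrite ?nnegrE ?mulr_ge0 //.
  by rewrite /B lerDl -mulrA mulr_ge0 // (le_trans ler01).
move=> i _; rewrite /lword /word_path.
case: s => [|a s]; first by rewrite Normc.normc0 !mulr_ge0 ?exprn_ge0 ?pwt_ge0.
case: insubP => [p _ pE|_]; last by rewrite Normc.normc0 !mulr_ge0 ?exprn_ge0
  ?pwt_ge0.
rewrite (le_trans (l_bound _ _ _)) //.
have -> : plen p = size (a :: s) by rewrite /plen /parrows pE.
by rewrite ler_wpM2l ?exprn_ge0.
Qed.

(** A decomposition with d factors meets at most k^d words, each with a coefficient bounded through
    L^d; the product costs 8^d and the factors contribute P0^d. As 8 k L P0 = 1 / 16, the total is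
    the sum estimated in [decomposition_list_weight] with x = 1 / 16, while the powers of A multiply
    to A^|w|. *)
Lemma rhs_coef_bound c b w m :
  (forall a u, gbound (P0 * (A ^+ plen u * pwt R (plen u))) B m (c a u)) ->
  normc (rhs_coef l c b w m) <=
    8 * (B ^+ m * pwt R m) * (A ^+ plen w * (2 * (16^-1 * pwt R (plen w)))).
Proof.
move=> hc; have L0 : 0 <= L := le_trans ler01 L1.
have k0 : 0 <= k := le_trans ler01 k1.
rewrite (le_trans (normc_sum _ _ _)) //.
pose wt (us : seq (qpath Q)) : R := \prod_(u <- us) (16^-1 * pwt R (plen u)).
have wt_ge0 us : 0 <= wt us.
  by apply: prodr_ge0 => u _; rewrite mulr_ge0 ?pwt_ge0 // invr_ge0.
apply: le_trans (_ : \sum_(us <- fset_set (decompositions w))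
    8 * (B ^+ m * pwt R m) * (A ^+ plen w * wt us) <= _); last first.
  rewrite -!mulr_sumr ler_wpM2l ?mulr_ge0 ?exprn_ge0 ?pwt_ge0 //.
  rewrite ler_wpM2l ?exprn_ge0 ?(ltW Agt0) //.
  apply: le_trans (@decomposition_list_weight R Q (plen w) w 16^-1 _ _);
    last 2 first.
  - by rewrite invr_ge0.
  - by rewrite mulfV // pnatr_eq0.
  rewrite [leLHS](_ : _ = \sum_(us <- fset_set (decompositions w)) wt us) //.
  apply: ler_sum_subset => //.
  move=> us; rewrite in_fset_set; last exact: finite_decompositions.
  by move=> /set_mem; exact: mem_decomposition_list.
rewrite big_seq [leRHS]big_seq; apply: ler_sum => us.
rewrite in_fset_set; last exact: finite_decompositions.
move=> /set_mem dus; rewrite (le_trans (normc_sum _ _ _)) //.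
set d := size us.
pose T : R := 8 * (L ^+ d * (8 ^+ d * \prod_(u <- us) (P0 * (A ^+ plen u * pwt R
  (plen u))))).
apply: le_trans (_ : \sum_(a : d.-tuple (arrow Q)) T * (B ^+ m * pwt R m) <= _).
  apply: ler_sum => a _.
  have h1 := @gbound_lword b a m; rewrite size_tuple in h1.
  have h2 := gbound_cprod Bge0 (fun i => hc (tnth a i) (tnth (in_tuple us) i)).
  have := gbound_conv Bge0 h1 h2; move=> /(_ m (leqnn _)) /le_trans; apply.
  rewrite le_eqVlt; apply/orP; left; apply/eqP; congr (_ * _).
  rewrite /T; congr (_ * (_ * (_ * _))).
  by rewrite [RHS](big_tnth _ _ us).
rewrite sumr_const card_tuple -(mulr_natr (T * _)) natrX.
have TE : T * #|arrow Q|%:R ^+ d =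
    8 * (A ^+ plen w * \prod_(u <- us) (8 * #|arrow Q|%:R * L * P0 * pwt R (plen
      u))).
  rewrite /T (plen_decomposition dus) /d; elim: (us) => [|u us' IH].
    by rewrite !big_nil /= !expr0; ring.
  rewrite !big_cons /= !exprS exprD.
  transitivity (L * 8 * P0 * (A ^+ plen u * pwt R (plen u)) * #|arrow Q|%:R *
      (8 * (L ^+ size us' * (8 ^+ size us' *
        \prod_(v <- us') (P0 * (A ^+ plen v * pwt R (plen v))))) *
      #|arrow Q|%:R ^+ size us')); first by ring.
  by rewrite IH; ring.
rewrite [leLHS]mulrAC TE [leRHS]mulrAC ler_wpM2r ?mulr_ge0 ?exprn_ge0 ?pwt_ge0 //.
rewrite ler_wpM2l // ler_wpM2l ?exprn_ge0 ?(ltW Agt0) //.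
apply: ler_prod => u _; apply/andP; split.
  by rewrite !mulr_ge0 ?pwt_ge0 ?(ltW P0gt0).
rewrite ler_wpM2r ?pwt_ge0 // /P0 ler_pdivrMr.
  rewrite [leRHS](_ : _ = 8 * k * L); last by field.
  by rewrite ler_wpM2r // ler_wpM2l // ler_nat.
by rewrite -mulrA mulr_gt0 // (lt_le_trans ltr01).
Qed.

(** In order 0 only w = b matters, where P0 A [pwt 1] = 1. In the next order, the bound on the
    right-hand side amounts to A^|w| B^M with the two weights, but without P0; the new factor B
    makes up for this. *)
Lemma sol_coef_gbound M b w :
  gbound (P0 * (A ^+ plen w * pwt R (plen w))) B M (sol_coef l b w).
Proof.
elim: M b w => [|M IH] b w i; rewrite -picard_sol_coef.
  rewrite leqn0 => /eqP -> /=; rewrite expr0 mul1r /init_coef.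
  have p0 : pwt R 0 = 1 by rewrite /pwt expr1n invr1.
  case: eqP => [e|_]; last by rewrite Normc.normc0 !mulr_ge0 ?exprn_ge0 ?pwt_ge0
    ?(ltW P0gt0) ?(ltW Agt0).
  rewrite Normc.normc1 p0 mulr1 /plen e /= expr1 /A /pwt mulrA mulrCA divff
    ?gt_eqF //.
  have -> : 2 ^+ 2 = 4 :> R by rewrite -natrX.
  by rewrite mulr1 divff // pnatr_eq0.
move=> iM; have [Mi|Mi] := leqP i M; first by rewrite picard_sol_coef; exact: IH.
have {iM Mi} -> : i = M.+1 by apply/eqP; rewrite eqn_leq iM Mi.
rewrite /= Normc.normcM Normc.normcV normc_nat.
rewrite ler_pdivrMr //.
apply: (le_trans (rhs_coef_bound b w (fun a u => IH a u))).
have M1 : 1 <= M.+1%:R :> R by rewrite ler1n.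
have pS := pwtS R M.
(* 512 / 128 = 4, the constant of [pwtS]. *)
have BP : 4 <= B * P0.
  rewrite /P0 ler_pdivlMr; last by rewrite -mulrA mulr_gt0 // (lt_le_trans ltr01).
  by rewrite /B -[128 * k * L]mulrA -[512 * k * L]mulrA; move: q0; lra.
have X0 : 0 <= A ^+ plen w * pwt R (plen w).
  by rewrite mulr_ge0 ?exprn_ge0 ?pwt_ge0 // ltW.
have BM : 0 <= B ^+ M by rewrite exprn_ge0.
have pM := pwt_ge0 R M.+1.
rewrite [leLHS](_ : _ = (A ^+ plen w * pwt R (plen w)) * (B ^+ M * pwt R M));
  last by field.
rewrite exprS.
rewrite [leRHS](_ : _ = (A ^+ plen w * pwt R (plen w)) * (B ^+ M * ((B * P0) *
  (pwt R M.+1 * M.+1%:R)))); last by ring.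
rewrite ler_wpM2l // ler_wpM2l // (le_trans pS) //.
by apply: ler_pM => //; rewrite ler_peMr.
Qed.

End Bound.

(** An analytic family allows no constant in front of A^|w|. The factor 1 / 2, available because P0
    <= 1 / 2, compensates the factor 2 which [psv_near0] loses in summing the series. *)
Lemma sol_coef_bound l (L q : R) : 1 <= L -> 0 <= q ->
  (forall b w m, normc (l b w m) <= L ^+ plen w * q ^+ m) ->
  exists A B : R, [/\ 0 < A, 0 < B &
    forall b w, pbound (A ^+ plen w / 2) B (sol_coef l b w)].
Proof.
move=> L1 q0 lb; have k1 : 1 <= #|arrow Q|.+1%:R :> R by rewrite ler1n.
have kL1 : 1 <= #|arrow Q|.+1%:R * L by rewrite mulr_ege1.
have kL0 : 0 < #|arrow Q|.+1%:R * L by rewrite (lt_le_trans ltr01).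
exists (4 / (128 * #|arrow Q|.+1%:R * L)^-1), (4 * q + 512 * #|arrow Q|.+1%:R * L).
split.
- by rewrite invrK !mulr_gt0 // (lt_le_trans ltr01).
- by rewrite ltr_wpDl ?mulr_ge0 // -mulrA mulr_gt0.
move=> b w m; rewrite (le_trans (sol_coef_gbound L1 q0 lb b w (leqnn m))) //.
set A := 4 / _; set B := 4 * q + _; set P := (_ * _)^-1.
have B0 : 0 <= B ^+ m.
  by rewrite exprn_ge0 // addr_ge0 ?mulr_ge0 // ?(le_trans ler01) // -mulrA
    mulr_ge0.
have A0 : 0 <= A ^+ plen w by rewrite exprn_ge0 // /A invrK !mulr_ge0 //
  (le_trans ler01).
have P2 : P <= 2^-1.
  by rewrite /P lef_pV2 ?posrE // -mulrA; [move: kL1; lra|rewrite mulr_gt0].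
have P0 : 0 <= P by rewrite invr_ge0 -mulrA mulr_ge0 // ltW.
apply: ler_pM; rewrite ?mulr_ge0 ?pwt_ge0 //.
  rewrite mulrC; apply: ler_pM; rewrite ?mulr_ge0 ?pwt_ge0 //.
  by rewrite ler_piMr // pwt_le1.
by rewrite ler_piMr // pwt_le1.
Qed.

End Recursion.

(** * Endomorphisms of the completed path algebra *)

Section Endomorphisms.
Variables (K : fieldType) (Q : quiver).
Local Notation A := (cpathalg K Q).
Implicit Types (f g h : A) (u : arrow Q -> A) (v : vertex Q) (w p : qpath Q) (a b
  : arrow Q).

Definition arr a : A := path_series K (parrow a).
Definition idem (v : vertex Q) : A := path_series K (ptriv v).

Lemma cpaddE f g w : (f + g) w = f w + g w. Proof. by []. Qed.
Lemma cpsubE f g w : (f - g) w = f w - g w. Proof. by []. Qed.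
Lemma cpscaleE (k : K) f w : (k *: f) w = k * f w. Proof. by []. Qed.
Lemma cpmulE f g w :
  (f * g) w = \sum_(j < (plen w).+1) f (ptake j w) * g (pdrop j w).
Proof. by []. Qed.
Lemma cponeE w : (1 : A) w = (plen w == 0%N)%:R. Proof. by []. Qed.

Lemma cpsumE (I : Type) (r : seq I) (P : pred I) (F : I -> A) w :
  (\sum_(i <- r | P i) F i) w = \sum_(i <- r | P i) F i w.
Proof. by elim/big_rec2: _ => // i y x _ <-. Qed.

Lemma cpscaleAl (k : K) f g : (k *: f) * g = k *: (f * g).
Proof.
apply/funext => w; rewrite cpscaleE !cpmulE mulr_sumr.
by apply: eq_bigr => j _; rewrite cpscaleE mulrA.
Qed.

Lemma cpscaleAr (k : K) f g : f * (k *: g) = k *: (f * g).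
Proof.
apply/funext => w; rewrite cpscaleE !cpmulE mulr_sumr.
by apply: eq_bigr => j _; rewrite cpscaleE mulrCA.
Qed.

Lemma plen0_triv w : plen w = 0%N -> w = ptriv (psrc w).
Proof. by move=> /size0nil e; apply: qpath_inj. Qed.

Lemma plen1_arrow w : plen w = 1%N -> exists a, w = parrow a.
Proof.
move=> w1; have := walk_parrows w; move: w1; rewrite /plen.
case E: (parrows w) => [|a [|]] //= _ /andP[/eqP e _]; exists a.
exact: qpath_inj.
Qed.

Lemma parrows_take j w : parrows (ptake j w) = take j (parrows w).
Proof. by []. Qed.

Lemma parrows_drop j w : parrows (pdrop j w) = drop j (parrows w).
Proof. by []. Qed.

(** The filtration by path length. It is separated ([order_ge_inf]), so identities can be proved
    modulo all orders, and complete, so corrections of increasing order can be summed. *)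
Definition order_ge n f := forall w, (plen w < n)%N -> f w = 0.

Lemma order_geD n f g : order_ge n f -> order_ge n g -> order_ge n (f + g).
Proof. by move=> hf hg w wn; rewrite cpaddE hf ?hg ?addr0. Qed.

Lemma order_geB n f g : order_ge n f -> order_ge n g -> order_ge n (f - g).
Proof. by move=> hf hg w wn; rewrite cpsubE hf ?hg ?subr0. Qed.

Lemma order_ge_subC n f g : order_ge n (f - g) -> order_ge n (g - f).
Proof. by move=> h w wn; rewrite cpsubE -opprB -cpsubE h ?oppr0. Qed.

Lemma order_ge_sum n (I : Type) (r : seq I) (P : pred I) (F : I -> A) :
  (forall i, P i -> order_ge n (F i)) -> order_ge n (\sum_(i <- r | P i) F i).
Proof. by move=> h w wn; rewrite cpsumE big1 // => i /h; apply. Qed.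

Lemma order_ge_le m n f : (m <= n)%N -> order_ge n f -> order_ge m f.
Proof. by move=> mn hf w wm; apply: hf; apply: leq_trans mn. Qed.

Lemma order_geM m n f g : order_ge m f -> order_ge n g -> order_ge (m + n) (f * g).
Proof.
move=> hf hg w wmn; rewrite cpmulE big1 // => j _.
have jw : (j <= plen w)%N by rewrite -ltnS.
have [jm|mj] := ltnP j m; first by rewrite hf ?mul0r // plen_take.
by rewrite hg ?mulr0 // plen_drop ltn_subLR // (leq_trans wmn) // leq_add2r.
Qed.

Lemma order_ge_inf f g : (forall n, order_ge n (f - g)) -> f = g.
Proof.
move=> h; apply/funext => w; apply/eqP; rewrite -subr_eq0 -cpsubE.
by apply/eqP/(h (plen w).+1).
Qed.

(* f = eps f + sum_a a (lquot a f), see lquot_decomposition. *)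
Definition eps f : A := fun w => if plen w == 0%N then f w else 0.

(* The path a w, a junk value unless w starts where a ends. *)
Definition pcons a w : qpath Q :=
  insubd (ptriv (src a)) (src a, a :: parrows w).

Definition lquot a f : A := fun w => if psrc w == tgt a then f (pcons a w) else 0.

Lemma pcons_val a w : psrc w = tgt a ->
  psrc (pcons a w) = src a /\ parrows (pcons a w) = a :: parrows w.
Proof.
move=> e; have h : walk (src a) (a :: parrows w).
  by rewrite /= eqxx -e walk_parrows.
by rewrite /pcons /psrc /parrows /insubd insubT.
Qed.

Lemma pcons_drop a w s : parrows w = a :: s ->
  psrc (pdrop 1 w) = tgt a /\ w = pcons a (pdrop 1 w).
Proof.
move=> e; have es : psrc (pdrop 1 w) = tgt a.
  by rewrite /psrc /= /ptgt parrows_take e /= take0.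
split => //; have [e1 e2] := pcons_val es.
apply: qpath_inj; rewrite ?e1 ?e2.
  by have := walk_parrows w; rewrite e /= => /andP[/eqP <-].
by rewrite parrows_drop e /= drop0.
Qed.

Lemma order_ge_lquot n a f : order_ge n.+1 f -> order_ge n (lquot a f).
Proof.
move=> hf w wn; rewrite /lquot; case: eqP => // e; apply: hf.
by rewrite /plen (pcons_val e).2.
Qed.

Lemma arr_mulE a f w : (arr a * f) w =
  if parrows w is b :: _ then if b == a then f (pdrop 1 w) else 0 else 0.
Proof.
rewrite cpmulE /arr /path_series; case E: (parrows w) => [|b s].
  rewrite big1 // => j _; case: eqP => [/(congr1 (@parrows Q))|_];
    last by rewrite mul0r.
  by rewrite parrows_take E.
have w1 : (1 < (plen w).+1)%N by rewrite /plen E.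
rewrite (bigD1 (Ordinal w1)) //= big1 ?addr0; last first.
  move=> j j1; case: eqP => [e|_]; last by rewrite mul0r.
  exfalso; move/eqP: j1; apply; apply: val_inj => /=.
  have jw : (j <= plen w)%N by rewrite -ltnS.
  by rewrite -(plen_take jw) e.
have [ba|ba] := eqVneq b a.
  rewrite (_ : ptake 1 w == parrow a) ?mul1r //; apply/eqP/qpath_inj.
    by have := walk_parrows w; rewrite E /= ba => /andP[/eqP e _]; exact: esym e.
  by rewrite parrows_take E /= take0 ba.
case: eqP => [/(congr1 (@parrows Q))|_]; last by rewrite mul0r.
by rewrite parrows_take E /= take0 => -[/eqP]; rewrite (negPf ba).
Qed.

Lemma lquot_decomposition f : f = eps f + \sum_a arr a * lquot a f.
Proof.
apply/funext => w; rewrite cpaddE cpsumE /eps.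
under eq_bigr do rewrite arr_mulE.
rewrite /plen; case E: (parrows w) => [|b s] /=; first by rewrite big1 ?addr0.
have [es ew] := pcons_drop E.
rewrite add0r (bigD1 b) //= eqxx big1 ?addr0; last first.
  by move=> a ab; rewrite eq_sym (negPf ab).
by rewrite /lquot es eqxx -ew.
Qed.

Lemma eps_idem f : eps f = \sum_v f (ptriv v) *: idem v.
Proof.
apply/funext => w; rewrite cpsumE /eps; case: eqP => [/plen0_triv|] w0.
  rewrite w0 (bigD1 (psrc w)) //= big1 ?addr0.
    by rewrite cpscaleE /idem /path_series eqxx mulr1.
  move=> v vw; rewrite cpscaleE /idem /path_series; case: eqP => [e|_];
    rewrite ?mulr0 //.
  by move: vw; rewrite -[psrc w]/(psrc (ptriv (psrc w))) e eqxx.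
rewrite big1 // => v _; rewrite cpscaleE /idem /path_series.
by case: eqP => [e|_]; rewrite ?mulr0 //; case: w0; rewrite e.
Qed.

Lemma eps_mul f g : (eps f * g) = (fun w => f (ptriv (psrc w)) * g w).
Proof.
apply/funext => w; rewrite cpmulE big_ord_recl /= pdrop0 ptake0 {1}/eps /=.
by rewrite big1 ?addr0 // => j _; rewrite /eps plen_take // mul0r.
Qed.

Lemma eps_linear (k : K) f g : eps (k *: f + g) = k *: eps f + eps g.
Proof.
apply/funext => w; rewrite !(cpaddE, cpscaleE) /eps; case: eqP => // _.
by rewrite mulr0 addr0.
Qed.

Lemma eps_epsM f g : eps (f * g) = eps f * eps g.
Proof.
apply/funext => w; rewrite eps_mul /eps; case: eqP => [w0|_]; last by rewrite mulr0.
by rewrite cpmulE w0 big_ord1 pdrop0 ptake0.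
Qed.

Lemma lquot_linear a (k : K) f g :
  lquot a (k *: f + g) = k *: lquot a f + lquot a g.
Proof.
apply/funext => w; rewrite !(cpaddE, cpscaleE) /lquot; case: eqP => // _.
by rewrite mulr0 addr0.
Qed.

(** A cut of the path a w lies either before a, where f contributes its constant term at the source
    of a, or after a. *)
Lemma lquotM a f g :
  lquot a (f * g) = f (ptriv (src a)) *: lquot a g + lquot a f * g.
Proof.
apply/funext => w; rewrite cpaddE cpscaleE [in RHS]cpmulE /lquot.
have [e|ne] := eqVneq (psrc w) (tgt a); last first.
  by rewrite mulr0 big1 ?addr0 // => j _; rewrite mul0r.
have [e1 e2] := pcons_val e.
have len : plen (pcons a w) = (plen w).+1 by rewrite /plen e2.
rewrite cpmulE len big_ord_recl /= ptake0 pdrop0 e1; congr (_ + _).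
apply: eq_bigr => j _.
have et : psrc (ptake j w) = tgt a by [].
have [t1 t2] := pcons_val et.
have -> : ptake (bump 0 j) (pcons a w) = pcons a (ptake j w).
  by apply: qpath_inj; rewrite ?t1 ?t2 // parrows_take e2.
congr (_ * g _); apply: qpath_inj; last by rewrite !parrows_drop e2.
rewrite -[LHS]/(ptgt (ptake (bump 0 j) (pcons a w))) -[RHS]/(ptgt (ptake j w)).
by rewrite /ptgt !parrows_take e2 /= et.
Qed.

Lemma eps_idem_id v : eps (idem v) = idem v.
Proof.
apply/funext => w; rewrite /eps /idem /path_series; case: eqP => // w0.
by case: eqP => // e; case: w0; rewrite e.
Qed.

Lemma lquot_idem a v : lquot a (idem v) = 0.
Proof.
apply/funext => w; rewrite /lquot /idem /path_series; case: eqP => // e.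
case: eqP => // /(congr1 (@plen Q)); by rewrite /plen (pcons_val e).2.
Qed.

Lemma eps_one : eps 1 = 1.
Proof.
apply/funext => w; rewrite /eps !cponeE; by case: eqP.
Qed.

Lemma lquot_one a : lquot a 1 = 0.
Proof.
apply/funext => w; rewrite /lquot cponeE; case: eqP => // e.
by rewrite /plen (pcons_val e).2.
Qed.

Lemma eps_arr a : eps (arr a) = 0.
Proof.
apply/funext => w; rewrite /eps /arr /path_series; case: eqP => // w0.
by case: eqP => // e; move: w0; rewrite e.
Qed.

Lemma lquot_arr a b : lquot b (arr a) = if b == a then idem (tgt a) else 0.
Proof.
apply/funext => w; rewrite /lquot /arr /path_series.
have [e|ne] := eqVneq (psrc w) (tgt b); last first.
  case: eqVneq => // ba; rewrite /idem /path_series -ba.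
  by case: eqP => // wt; move: ne; rewrite wt eqxx.
have [e1 e2] := pcons_val e; have [ba|nba] := eqVneq b a; last first.
  case: eqP => // /(congr1 (@parrows Q)); rewrite e2 => -[/eqP].
  by rewrite (negPf nba).
rewrite /idem /path_series; congr (_ %:R); congr nat_of_bool; apply/eqP/eqP.
  move=> /(congr1 (@parrows Q)); rewrite e2 => -[] _ w0.
  by apply: qpath_inj; rewrite // e ba.
by move=> w0; apply: qpath_inj; rewrite ?e1 ?e2 ?w0 ba.
Qed.

(** * Extension of the images of the arrows to an endomorphism *)

Section Extension.
Variable u : arrow Q -> A.
Hypothesis u_parallel : forall a w, ~~ parallel a w -> u a w = 0.
Hypothesis u_triv : forall a v, u a (ptriv v) = 0.

Lemma u_order a : order_ge 1 (u a).
Proof. by move=> w; rewrite ltnS leqn0 => /eqP/plen0_triv ->. Qed.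

(** All paths in u a start at the source of a, so the other idempotents in [eps f] annihilate it. *)
Lemma eps_u f a : eps f * u a = f (ptriv (src a)) *: u a.
Proof.
rewrite eps_mul; apply/funext => w; rewrite cpscaleE.
have [->|ne] := eqVneq (psrc w) (src a); first by [].
by rewrite u_parallel ?mulr0 // /parallel eq_sym (negPf ne).
Qed.

Lemma u_idem a : u a * idem (tgt a) = u a.
Proof.
apply/funext => w; rewrite cpmulE big_ord_recr /= ptake_size big1 ?add0r.
  rewrite /idem /path_series.
  have [e|ne] := eqVneq (pdrop (plen w) w) (ptriv (tgt a)); first by rewrite mulr1.
  rewrite mulr0 u_parallel //; apply: contra ne => /andP[_ /eqP e];
    apply/eqP/qpath_inj.
    by rewrite /psrc /= -/(ptgt _) ptake_size e.
  by rewrite parrows_drop drop_oversize.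
move=> j _; rewrite /idem /path_series; case: eqP => [|_]; last by rewrite mulr0.
move=> /(congr1 (@plen Q)); rewrite plen_drop => /eqP.
by rewrite subn_eq0 leqNgt ltn_ord.
Qed.

(* The extension of u to an endomorphism, by recursion on the order n of
   truncation. *)
Fixpoint extn n f : A :=
  if n is n'.+1 then eps f + \sum_a u a * extn n' (lquot a f) else 0.

(** At a path of length n the truncation n + 1 is already final, by [extn_agree]. *)
Definition ext f : A := fun w => extn (plen w).+1 f w.

Lemma extn_agree n m f : order_ge n (extn n f - extn (n + m) f).
Proof.
elim: n f => [|n IH] f //=.
rewrite opprD addrACA subrr add0r -sumrB.
apply: order_ge_sum => a _; rewrite -mulrBr -add1n.
by apply: order_geM; [exact: u_order|exact: IH].
Qed.

Lemma ext_extn n f : order_ge n (ext f - extn n f).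
Proof.
move=> w wn; rewrite cpsubE /ext.
have := @extn_agree (plen w).+1 (n - (plen w).+1) f w (ltnSn _).
by rewrite cpsubE subnKC.
Qed.

Lemma extE f : ext f = eps f + \sum_a u a * ext (lquot a f).
Proof.
apply: order_ge_inf => n.
rewrite -(subrK (extn n.+1 f) (ext f)) -addrA; apply: order_geD.
  exact: (@order_ge_le n n.+1 _ (leqnSn n) (@ext_extn n.+1 f)).
rewrite /= opprD addrACA subrr add0r -sumrB.
apply: order_ge_sum => a _; rewrite -mulrBr; apply: (@order_ge_le n n.+1) => //.
rewrite -add1n; apply: order_geM; first exact: u_order.
exact/order_ge_subC/ext_extn.
Qed.

(** The u a have order at least 1, so agreement modulo order n for all arguments improves to order n
    + 1. Linearity and multiplicativity of [ext] rest on the same principle. *)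
Lemma ext_uniq (F : A -> A) :
  (forall f, F f = eps f + \sum_a u a * F (lquot a f)) -> F =1 ext.
Proof.
move=> hF f; apply: order_ge_inf => n; elim: n f => [|n IH] f //.
rewrite hF extE opprD addrACA subrr add0r -sumrB.
apply: order_ge_sum => a _; rewrite -mulrBr -add1n.
by apply: order_geM; [exact: u_order|exact: IH].
Qed.

Lemma ext_linear : linear ext.
Proof.
move=> k f g; apply: order_ge_inf => n; elim: n f g => [|n IH] f g //.
rewrite (extE (k *: f + g)) (extE f) (extE g) eps_linear.
rewrite scalerDr addrACA opprD addrACA subrr add0r scaler_sumr -big_split -sumrB.
apply: order_ge_sum => a _; rewrite lquot_linear /= -cpscaleAr -mulrDr -mulrBr
  -add1n.
by apply: order_geM; [exact: u_order|exact: IH].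
Qed.

Lemma ext0 : ext 0 = 0.
Proof. by have := ext_linear (-1) 0 0; rewrite scaler0 addr0 scaleN1r addNr. Qed.

(** Expanding both sides by the recursion, [lquotM] and [eps_u] match the terms involving the
    constant part of f. What is left is u a times the defect of multiplicativity for [lquot a f] and
    g, one order better. *)
Lemma extM f g : ext (f * g) = ext f * ext g.
Proof.
apply: order_ge_inf => n; elim: n f g => [|n IH] f g //.
have e : eps f * ext g = eps f * eps g + \sum_a eps f * (u a * ext (lquot a g)).
  by rewrite {1}(extE g) mulrDr mulr_sumr.
rewrite (extE (f * g)) (extE f) eps_epsM mulrDl e -[X in _ - X]addrA.
rewrite opprD addrACA subrr add0r mulr_suml -big_split -sumrB.
apply: order_ge_sum => a _; rewrite lquotM /= ext_linear mulrA eps_u.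
rewrite mulrDr cpscaleAr cpscaleAl opprD addrACA subrr add0r -mulrA -mulrBr -add1n.
by apply: order_geM; [exact: u_order|exact: IH].
Qed.

Lemma ext_one : ext 1 = 1.
Proof.
rewrite extE eps_one big1 ?addr0 // => a _.
by rewrite lquot_one ext0 mulr0.
Qed.

Lemma ext_idem v : ext (idem v) = idem v.
Proof.
rewrite extE eps_idem_id big1 ?addr0 // => a _.
by rewrite lquot_idem ext0 mulr0.
Qed.

Lemma ext_arr a : ext (arr a) = u a.
Proof.
rewrite extE eps_arr add0r (bigD1 a) //= lquot_arr eqxx ext_idem u_idem.
rewrite big1 ?addr0 // => b ba; rewrite lquot_arr (negPf ba) ext0 mulr0 //.
Qed.

Lemma ext_endo : is_endo ext.
Proof.
split; [exact: ext_linear| |exact: ext_idem].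
by split; [exact: ext_one|exact: extM].
Qed.

End Extension.

(** * Arbitrary endomorphisms and the filtration by length *)

Section Endo.
Variable psi : A -> A.
Hypothesis psi_endo : is_endo psi.

Lemma endoP (k : K) f g : psi (k *: f + g) = k *: psi f + psi g.
Proof. by case: psi_endo => h _ _; exact: h. Qed.

Lemma endo0 : psi 0 = 0.
Proof. by have := endoP (-1) 0 0; rewrite scaler0 addr0 scaleN1r addNr. Qed.

Lemma endoZ (k : K) f : psi (k *: f) = k *: psi f.
Proof. by have := endoP k f 0; rewrite endo0 !addr0. Qed.

Lemma endoD f g : psi (f + g) = psi f + psi g.
Proof. by have := endoP 1 f g; rewrite !scale1r. Qed.

Lemma endoB f g : psi (f - g) = psi f - psi g.
Proof. by rewrite endoD -scaleN1r endoZ scaleN1r. Qed.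

Lemma endo_sum (I : Type) (r : seq I) (P : pred I) (F : I -> A) :
  psi (\sum_(i <- r | P i) F i) = \sum_(i <- r | P i) psi (F i).
Proof. exact: (big_morph psi endoD endo0). Qed.

Lemma endoM f g : psi (f * g) = psi f * psi g.
Proof. by case: psi_endo => _ [_ h] _; exact: h. Qed.

Lemma endo_eps f : psi (eps f) = eps f.
Proof.
rewrite eps_idem endo_sum; apply: eq_bigr => v _; rewrite endoZ.
by case: psi_endo => _ _ ->.
Qed.

(** The decomposition of f is a finite sum, to which the algebraic rules apply. Together with
    [ext_uniq] this gives uniqueness among endomorphisms that are not assumed continuous. *)
Lemma endoE f : psi f = eps f + \sum_a psi (arr a) * psi (lquot a f).
Proof.
rewrite {1}(lquot_decomposition f) endoD endo_eps endo_sum; congr (_ + _).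
by apply: eq_bigr => a _; rewrite endoM.
Qed.

Lemma eps_order n f : order_ge n.+1 f -> eps f = 0.
Proof. by move=> h; apply/funext => w; rewrite /eps; case: eqP => // w0;
  rewrite h ?w0. Qed.

Lemma endo_order n f : (forall a, order_ge 1 (psi (arr a))) ->
  order_ge n f -> order_ge n (psi f).
Proof.
move=> h; elim: n f => [|n IH] f hf //.
rewrite endoE (eps_order hf) add0r; apply: order_ge_sum => a _.
by rewrite -add1n; apply: order_geM => //; apply/IH/order_ge_lquot.
Qed.

Lemma arr_order a : order_ge 1 (arr a).
Proof.
move=> w; rewrite ltnS leqn0 => /eqP w0; rewrite /arr /path_series.
by case: eqP => // e; move: w0; rewrite e.
Qed.

(** For a term a f' one has psi(a f') - a f' = (psi(a) - a) psi(f') + a (psi(f') - f'). The first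
    summand gains an order from the arrow, the second by induction. *)
Lemma endo_near_id n f : (forall a, order_ge 2 (psi (arr a) - arr a)) ->
  order_ge n f -> order_ge n.+1 (psi f - f).
Proof.
move=> h.
have h1 a : order_ge 1 (psi (arr a)).
  rewrite -(subrK (arr a) (psi _)); apply: order_geD; last exact: arr_order.
  exact: order_ge_le (h a).
elim: n f => [|n IH] f hf.
  rewrite endoE {3}(lquot_decomposition f) opprD addrACA subrr add0r -sumrB.
  apply: order_ge_sum => a _; apply: order_geB; rewrite -(addn0 1%N).
    exact: order_geM.
  by apply: order_geM => //; exact: arr_order.
rewrite endoE {3}(lquot_decomposition f) opprD addrACA subrr add0r -sumrB.
apply: order_ge_sum => a _; have hq := @order_ge_lquot n a f hf.
rewrite [X in order_ge _ X](_ : _ = (psi (arr a) - arr a) * psi (lquot a f) +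
  arr a * (psi (lquot a f) - lquot a f)); last first.
  by rewrite mulrBl mulrBr addrA subrK.
apply: order_geD; first by rewrite -add2n; apply: order_geM => //;
  exact: endo_order.
by rewrite -add1n; apply: order_geM; [exact: arr_order|exact: IH].
Qed.

End Endo.

(** Injectivity: the difference of two preimages lies in every order. Surjectivity: adding the
    current error g - T f to f raises the order of the error, and the iterates stabilize
    coefficientwise. *)
Lemma near_id_bijective (T : A -> A) : (forall f g, T (f - g) = T f - T g) ->
  (forall n f, order_ge n f -> order_ge n.+1 (T f - f)) -> bijective T.
Proof.
move=> TB Tid.
have T_order n f : order_ge n f -> order_ge n (T f).
  move=> hf; rewrite -(subrK f (T f)); apply: order_geD => //.
  exact: order_ge_le (Tid _ _ hf).
have Tinj : injective T.
  move=> f g fg; apply: order_ge_inf => n; elim: n => [|n IH] //.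
  by have := Tid _ _ IH; rewrite TB fg subrr => /order_ge_subC; rewrite subr0.
have Tsurj g : exists f, T f = g.
  pose fk := fix F k := if k is k'.+1 then F k' + (g - T (F k')) else 0.
  have T0 : T 0 = 0 by have := TB 0 0; rewrite !subrr.
  have TD f h : T (f + h) = T f + T h by have := TB f (0 - h);
    rewrite (TB 0) T0 !sub0r !opprK.
  have fkg k : order_ge k (g - T (fk k)).
    elim: k => [|k IH] //=; rewrite TD opprD addrA.
    exact/order_ge_subC/Tid.
  have fkk k j : order_ge k (fk k - fk (k + j)%N).
    elim: j => [|j IH]; first by rewrite addn0 subrr.
    rewrite addnS /= opprD addrA; apply: order_geB => //.
    by apply: order_ge_le (fkg _); exact: leq_addr.
  pose f : A := fun w => fk (plen w).+1 w.
  have ffk k : order_ge k (f - fk k).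
    move=> w wk; have := fkk (plen w).+1 (k - (plen w).+1)%N w (ltnSn _).
    by rewrite subnKC.
  exists f; apply: order_ge_inf => n.
  rewrite -(subrK (T (fk n)) (T f)) -addrA -TB; apply: order_geD.
    exact/T_order.
  exact/order_ge_subC/fkg.
have /choice[S ST] := Tsurj.
by exists S => // f; apply: Tinj; rewrite ST.
Qed.

Lemma endo_comp phi psi : is_endo phi -> is_endo psi ->
  is_endo (K := K) (Q := Q) (phi \o psi).
Proof.
move=> [p1 [p2 p3] p4] [q1 [q2 q3] q4]; split; last by move=> v /=; rewrite q4 p4.
  by move=> k f g /=; rewrite q1 p1.
by split => [|f g] /=; rewrite ?q2 ?p2 ?q3 ?p3.
Qed.

Lemma endo_near_id_bijective psi : is_endo psi ->
  (forall a, order_ge 2 (psi (arr a) - arr a)) -> bijective psi.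
Proof.
move=> pe h; apply: near_id_bijective => [f g|n f hf]; first exact: endoB.
exact: endo_near_id.
Qed.

Lemma order_ge2P f : (forall v, f (ptriv v) = 0) -> (forall a, f (parrow a) = 0) ->
  order_ge 2 f.
Proof.
move=> h0 h1 w; rewrite ltnS leq_eqVlt => /orP[/eqP/plen1_arrow[a ->]//|].
by rewrite ltnS leqn0 => /eqP/plen0_triv ->.
Qed.

Lemma arr_triv a v : arr a (ptriv v) = 0.
Proof. exact: arr_order. Qed.

Lemma arr_parrow a b : arr a (parrow b) = (b == a)%:R.
Proof.
rewrite /arr /path_series; congr (_ %:R); congr nat_of_bool.
by apply/eqP/eqP => [/(congr1 (@parrows Q)) []|->].
Qed.

Theorem invertible_linear_part u (N : arrow Q -> arrow Q -> K) :
  (forall a w, ~~ parallel a w -> u a w = 0) ->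
  (forall a v, u a (ptriv v) = 0) ->
  (forall a c, \sum_b N a b * u b (parrow c) = (a == c)%:R) ->
  (forall a c, \sum_b u a (parrow b) * N b c = (a == c)%:R) ->
  invertible u.
Proof.
move=> upar utriv NL LN.
pose par a b := parallel a (parrow b).
have parE a b : par a b = (src a == src b) && (tgt a == tgt b) by [].
(* [N] is cut down to parallel arrows so that v extends to an endomorphism. If a and c are parallel,
   the discarded entries only meet vanishing coefficients of u; otherwise the entry in question is 0
   anyway. *)
pose v a : A := \sum_b (if par a b then N a b else 0) *: arr b.
have v_parrow a c : v a (parrow c) = if par a c then N a c else 0.
  rewrite /v cpsumE (bigD1 c) //= cpscaleE arr_parrow eqxx mulr1 big1 ?addr0 //.
  by move=> b bc; rewrite cpscaleE arr_parrow eq_sym (negPf bc) mulr0.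
have v_triv a x : v a (ptriv x) = 0.
  by rewrite /v cpsumE big1 // => b _; rewrite cpscaleE arr_triv mulr0.
have v_par a w : ~~ parallel a w -> v a w = 0.
  move=> aw; rewrite /v cpsumE big1 // => b _; rewrite cpscaleE /arr /path_series.
  case: eqP => [e|_]; last by rewrite mulr0.
  by rewrite /par -e (negPf aw) mul0r.
have ue := ext_endo upar utriv; have ve := ext_endo v_par v_triv.
have ua := ext_arr upar utriv; have va := ext_arr v_par v_triv.
have u_zero a b : ~~ par a b -> u a (parrow b) = 0 by exact: upar.
have b1 : bijective (ext u \o ext v).
  apply: endo_near_id_bijective; first exact: endo_comp.
  move=> a /=; rewrite va /v (endo_sum ue).
  apply: order_ge2P => [x|c]; rewrite cpsubE cpsumE.
    rewrite arr_triv subr0 big1 // => b _.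
    by rewrite (endoZ ue) cpscaleE ua utriv mulr0.
  rewrite arr_parrow eq_sym -NL; apply/eqP; rewrite subr_eq0; apply/eqP.
  have [pac|npac] := boolP (par a c).
    apply: eq_bigr => b _; rewrite (endoZ ue) cpscaleE ua; case: ifPn => // npab.
    rewrite mul0r u_zero ?mulr0 //; apply: contra npab.
    by move: pac; rewrite !parE => /andP[/eqP -> /eqP ->];
      rewrite ![_ == src b]eq_sym ![_ == tgt b]eq_sym.
  rewrite NL big1 => [|b _].
    case: eqVneq => // ac; by move: npac; rewrite ac parE !eqxx.
  rewrite (endoZ ue) cpscaleE ua; case: ifPn => [pab|_]; last by rewrite mul0r.
  rewrite u_zero ?mulr0 //; apply: contra npac => pbc.
  by move: pab pbc; rewrite !parE => /andP[/eqP -> /eqP ->].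
have b2 : bijective (ext v \o ext u).
  apply: endo_near_id_bijective; first exact: endo_comp.
  move=> a /=; rewrite ua.
  have v1 c : order_ge 1 (ext v (arr c)) by rewrite va; exact: u_order v_triv c.
  (* As [ext v] preserves the order, u a may be replaced by its linear part modulo order 2. *)
  have u2 : order_ge 2 (u a - \sum_b u a (parrow b) *: arr b).
    apply: order_ge2P => [x|c]; rewrite cpsubE cpsumE.
      by rewrite utriv big1 ?subr0 // => b _; rewrite cpscaleE arr_triv mulr0.
    rewrite (bigD1 c) //= cpscaleE arr_parrow eqxx mulr1 big1 ?addr0 ?subrr // =>
      b bc.
    by rewrite cpscaleE arr_parrow eq_sym (negPf bc) mulr0.
  rewrite -(subrK (ext v (\sum_b u a (parrow b) *: arr b)) (ext v (u a))) -addrA.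
  apply: order_geD; first by rewrite -(endoB ve); exact: endo_order.
  rewrite (endo_sum ve); apply: order_ge2P => [x|c]; rewrite cpsubE cpsumE.
    rewrite arr_triv subr0 big1 // => b _.
    by rewrite (endoZ ve) cpscaleE va v_triv mulr0.
  rewrite arr_parrow eq_sym -LN; apply/eqP; rewrite subr_eq0; apply/eqP.
  have [pac|npac] := boolP (par a c).
    apply: eq_bigr => b _; rewrite (endoZ ve) cpscaleE va v_parrow;
      case: ifPn => // npbc.
    rewrite u_zero ?mul0r //; apply: contra npbc.
    by move: pac; rewrite !parE => /andP[/eqP -> /eqP ->];
      rewrite ![_ == src b]eq_sym ![_ == tgt b]eq_sym.
  rewrite LN big1 => [|b _].
    case: eqVneq => // ac; by move: npac; rewrite ac parE !eqxx.
  rewrite (endoZ ve) cpscaleE va v_parrow; case: ifPn => [pbc|_];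
    last by rewrite mulr0.
  rewrite u_zero ?mul0r //; apply: contra npac => pab.
  by move: pab pbc; rewrite !parE => /andP[/eqP -> /eqP ->].
exists (ext u); split => //.
- move=> psi pe pu; apply: (ext_uniq utriv) => f; rewrite {1}(endoE pe).
  by congr (_ + _); apply: eq_bigr => a _; rewrite pu.
(* The left inverse comes from [b2]; it is also a right inverse, since by [b1] every f is in the
   image of [ext u]. *)
- have [g1 g1K _] := b2; have [g2 _ g2K] := b1.
  exists (g1 \o ext v) => f /=; first exact: g1K.
  have := g2K f; rewrite /= => e2; rewrite -{1}e2.
  by have := g1K (ext v (g2 f)); rewrite /= => ->; exact: e2.
Qed.

End Endomorphisms.

(** * The initial value problem *)

Lemma det_inverse (K : fieldType) (I : finType) (L : I -> I -> K) :
  \det (\matrix_(i < #|I|, j < #|I|) L (enum_val i) (enum_val j)) != 0 ->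
  exists N : I -> I -> K,
    (forall a c, \sum_b N a b * L b c = (a == c)%:R) /\
    (forall a c, \sum_b L a b * N b c = (a == c)%:R).
Proof.
set Lm := \matrix_(_, _) _ => dL.
have uL : Lm \in unitmx by rewrite unitmxE unitfE.
exists (fun a b => invmx Lm (enum_rank a) (enum_rank b)); split => a c.
  have := congr1 (fun X : 'M_#|I| => X (enum_rank a) (enum_rank c)) (mulVmx uL).
  rewrite !mxE (inj_eq enum_rank_inj) => <-.
  rewrite (reindex (@enum_val I (mem I))); last exact/onW_bij/enum_val_bij.
  by apply: eq_bigr => i _; rewrite enum_valK mxE enum_rankK.
have := congr1 (fun X : 'M_#|I| => X (enum_rank a) (enum_rank c)) (mulmxV uL).
rewrite !mxE (inj_eq enum_rank_inj) => <-.
rewrite (reindex (@enum_val I (mem I))); last exact/onW_bij/enum_val_bij.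
by apply: eq_bigr => i _; rewrite enum_valK mxE enum_rankK.
Qed.

Section Solution.
Variables (R : realType) (Q : quiver).
Local Notation C := R[i].
Local Notation coefs := (arrow Q -> qpath Q -> nat -> C).
Implicit Types (b : arrow Q) (w : qpath Q).

Lemma hasps_cprod d (F : 'I_d -> nat -> C) (y : 'I_d -> C) (t : C) :
  (forall i, hasps (F i) t (y i)) -> hasps (cprod F) t (\prod_(i < d) y i).
Proof.
elim: d F y => [|d IH] F y h.
  by rewrite /cprod !big_ord0; exact: hasps_cst.
by rewrite cprodS big_ord_recl; apply: hasps_mul => //; exact: IH.
Qed.

Lemma hasps_ode_rhs (l c : coefs) (lam gam : arrow Q -> qpath Q -> C -> C) b w (t
  : C) :
  (forall p, hasps (l b p) t (lam b p t)) ->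
  (forall us a u, decompositions w us -> u \in us -> hasps (c a u) t (gam a u t)) ->
  hasps (rhs_coef l c b w) t (ode_rhs (R := R) lam gam b w t).
Proof.
move=> hl hc.
have -> : ode_rhs (R := R) lam gam b w t =
    \sum_(us <- fset_set (decompositions w)) \sum_(a : (size us).-tuple (arrow Q))
      (word_coef (R := R) (lam b) a t : C) *
      \prod_(i < size us) gam (tnth a i) (tnth (in_tuple us) i) t.
  by rewrite /ode_rhs fsbig_finite //; exact: finite_decompositions.
rewrite big_seq [rhs_coef _ _ _ _](_ : _ = fun m =>
    \sum_(us <- fset_set (decompositions w) | us \in fset_set (decompositions w))
      \sum_(a : (size us).-tuple (arrow Q)) conv (lword l b a)
      (cprod (fun i => c (tnth a i) (tnth (in_tuple us) i))) m); last first.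
  by apply/funext => m; rewrite /rhs_coef big_seq.
apply: hasps_sum => us; rewrite in_fset_set; last exact: finite_decompositions.
move=> /set_mem dus; apply: hasps_sum => a _; apply: hasps_mul.
  rewrite /lword /word_coef; case: (word_path a) => [p|]; first exact: hl.
  exact: hasps_zero.
by apply: hasps_cprod => i; apply: hc dus _; exact: mem_tnth.
Qed.

(** The difference quotient at t0 is the value of [psquot a t0] at a nearby point, and this quotient
    is continuous; its value at t0 is the sum of the derived series by [cvg_psderiv]. *)
Lemma is_derive_psv (M s e : R) (a : nat -> C) (f : R[i]^o -> R[i]^o) (t0 d : C) :
  0 < s -> s * normc t0 < 1 -> pbound M s a -> 0 < e ->
  (forall t, normc (t - t0) < e -> f t = psv a t) ->
  cvgC (psum (pterm (fun n => n.+1%:R * a n.+1) t0)) d ->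
  is_derive (t0 : R[i]^o) (1 : R[i]^o) f (d : R[i]^o).
Proof.
move=> s0 st0 ab e0 fE hd.
have gd : psv (psquot a t0) t0 = d := cvgC_uniq (cvg_psderiv (ltW s0) st0 ab) hd.
have gb := pbound_psquot (ltW s0) st0 ab.
have gc := analytic_continuous (analytic_psv s0 st0 gb).
have st1 : 0 < s^-1 - normc t0 by move: st0; rewrite subr_gt0 -ltr_pdivlMl // mulr1.
suff H : (fun h : R[i]^o => h^-1 *: ((f \o shift (t0 : R[i]^o)) (h *: (1 :
  R[i]^o)) - f t0))
    @ (0 : R[i]^o)^' --> (d : R[i]^o).
  by apply: DeriveDef; [exact: cvgP H|exact: cvg_lim H].
apply/cvgrPdist_lt => z z0; have [k zk] := complex_realP _ (gtr0_real z0).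
rewrite zk ltcR in z0 *.
have [del del0 hdel] := gc _ z0.
suff : \forall h \near (0 : R[i]^o), h != 0 ->
  `|(d : R[i]^o) - h^-1 *: ((f \o shift (t0 : R[i]^o)) (h *: (1 : R[i]^o)) - f
    t0)| < ((k%:C)%C : R[i]) by [].
apply/nearcP; exists (Num.min del (Num.min e (s^-1 - normc t0))).
  by rewrite !lt_min del0 e0.
move=> h; rewrite subr0 !lt_min => /andP[h1 /andP[h2 h3]] hn0.
have key : forall x : C, normc x < e -> normc x < s^-1 - normc t0 ->
    f (x + t0) - f t0 = x * psv (psquot a t0) (x + t0) :> C.
  move=> x xe xs; rewrite (fE (x + t0)) ?addrK // (fE t0); last first.
    by rewrite subrr Normc.normc0.
  have sx : s * normc (x + t0) < 1.
    by rewrite -ltr_pdivlMl // mulr1 (le_lt_trans (normcD _ _)) // -ltrBrDr.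
  by rewrite (psv_psquot (ltW s0) st0 ab sx) addrAC subrr add0r addrK.
have val : h^-1 *: ((f \o shift (t0 : R[i]^o)) (h *: (1 : R[i]^o)) - f t0) =
    psv (psquot a t0) ((h : C) + t0) :> C.
  have -> : (f \o shift (t0 : R[i]^o)) (h *: (1 : R[i]^o)) = f ((h : C) + t0).
    rewrite /= /shift; congr (f (_ + _)); exact: mulr1.
  rewrite (key h h2 h3); exact: mulKf.
rewrite val normc_norm ltcR normc_distC -gd; apply: hdel.
by rewrite (addrK (t0 : C) (h : C)).
Qed.

Lemma pbound_deriv (M s : R) (a : nat -> C) : 0 <= s -> pbound M s a ->
  pbound (M * s) (2 * s) (fun n => n.+1%:R * a n.+1).
Proof.
move=> s0 ab n; have M0 := pbound_ge0 ab.
rewrite Normc.normcM normc_nat exprMn [leRHS]mulrCA -[M * s * _]mulrA -exprS.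
apply: ler_pM => //; rewrite ?normc_ge0 //.
by rewrite -natrX ler_nat; exact: ltn_expl.
Qed.

(** A trivial path has no decomposition into nontrivial ones, so its coefficient keeps the initial
    value 0. *)
Lemma sol_coef_triv (l : coefs) b w m : plen w = 0%N -> sol_coef l b w m = 0.
Proof.
move=> w0; rewrite -picard_sol_coef; case: m => [|m] /=.
  by rewrite /init_coef; case: eqP => // e; move: w0; rewrite /plen e.
rewrite /rhs_coef big_seq big1 ?mul0r // => us.
rewrite in_fset_set; last exact: finite_decompositions.
by move=> /set_mem/(@mem_decomposition_list Q 0 w); rewrite w0 => /(_ isT).
Qed.

Lemma nonvanishing_near (f : C -> C) : analytic_at f 0 -> f 0 = 1 ->
  exists2 d : R, 0 < d & forall t, normc t < d -> f t != 0.
Proof.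
move=> fan f1; have [d d0 hd] := analytic_continuous fan ltr01.
exists d => // t td; apply/eqP => ft0; have h : normc (t - 0) < d by rewrite subr0.
by have := hd t h; rewrite f1 ft0 sub0r normcN Normc.normc1 ltxx.
Qed.

Lemma common_radius (T : eqType) (P : T -> C -> Prop) (xs : seq T) :
  (forall x, exists2 e : R, 0 < e & forall t, normc t < e -> P x t) ->
  exists2 e : R, 0 < e & forall t, normc t < e -> forall x, x \in xs -> P x t.
Proof.
move=> h; elim: xs => [|x xs [e e0 IH]]; first by exists 1.
have [d d0 hd] := h x; exists (Num.min d e); first by rewrite lt_min d0.
move=> t; rewrite lt_min => /andP[td te] y; rewrite inE => /orP[/eqP ->|];
  first exact: hd.
exact: IH.
Qed.

(** The derivative of an arbitrary analytic solution has two expansions at 0, one by termwise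
    differentiation and one by substitution into the right-hand side; comparing them gives the
    recursion. *)
Lemma ivp_coefs (l c : coefs) (lam gam : arrow Q -> qpath Q -> C -> C)
    (V : set R[i]^o) (r : R) :
  0 < r -> (forall t, normc t < r -> V t) ->
  (forall b p t, normc t < r -> hasps (l b p) t (lam b p t)) ->
  ivp_solution (R := R) V lam gam ->
  (forall b w, expansion (gam b w) 0 (c b w)) ->
  forall b w m, picard l c b w m = c b w m.
Proof.
move=> r0 rV hl ivp gc b w [|m] /=; have [gd _ gi g0] := ivp b w.
  rewrite -(expansion_at (gc b w)) /init_coef.
  have [w1|w1] := eqVneq (plen w) 1%N; last first.
    rewrite g0 //; case: eqP => // e; by move: w1; rewrite /plen e.
  have [a wa] := plen1_arrow w1; rewrite wa gi; congr (_ %:R); congr nat_of_bool.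
  by rewrite eq_sym; apply/eqP/eqP => [[->]|->].
have e1 : expansion (fun t => ode_rhs (R := R) lam gam b w t : C) 0 (rhs_coef l c
  b w).
  (* Each coefficient of the given solution has its own radius, but only finitely many occur in the
     equation for b and w. *)
  pose us := flatten (finmap.enum_fset (fset_set (decompositions w))).
  have [|e e0 he] := @common_radius (arrow Q * qpath Q)%type
      (fun x t => hasps (c x.1 x.2) t (gam x.1 x.2 t)) [seq (a, u) | a <- enum
        (arrow Q), u <- us].
    move=> [a u]; have [e e0 he] := expansion_hasps (gc a u); exists e => // t te.
    by have := he t; rewrite subr0; apply.
  apply: (hasps_expansion (e := Num.min e r)); first by rewrite lt_min e0.
  move=> t; rewrite subr0 lt_min => /andP[te tr]; apply: hasps_ode_rhs.
    by move=> p; exact: hl.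
  move=> us0 a u dus uus; apply: (he t te (a, u)); apply/allpairsP; exists (a, u).
  split => //; first by rewrite mem_enum.
  apply/flattenP; exists us0 => //.
  by rewrite in_fset_set; [exact/mem_set|exact: finite_decompositions].
have e2 : expansion (fun t => ode_rhs (R := R) lam gam b w t : C) 0
    (fun n => n.+1%:R * c b w n.+1).
  have [M [s [s0 cb h]]] := gc b w.
  apply: (@expansion_near _ (fun t => psv (fun n => n.+1%:R * c b w n.+1) (t -
    0)) _ _ _
      (Num.min s^-1 r)); last first.
    exists (M * s), (2 * s); split => //; first by rewrite mulr_gt0.
    exact: pbound_deriv (ltW s0) cb.
  - move=> t; rewrite subr0 lt_min => /andP[ts tr].
    have st : s * normc t < 1 by rewrite -ltr_pdivlMl // mulr1.
    have hd := cvg_psderiv (ltW s0) st cb.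
    have e0 : 0 < s^-1 - normc t by rewrite subr_gt0.
    have [|] := is_derive_psv (f := gam b w) s0 st cb e0 _ hd.
      move=> z hz; have := h z; rewrite subr0; apply; rewrite -ltr_pdivlMl // mulr1.
      by rewrite -(subrK t z) (le_lt_trans (normcD _ _)) // -ltrBrDr.
    move=> _ dv; have [_] := gd t (rV t tr); rewrite dv => dE.
    by rewrite (cvg_psv hd).
  - by rewrite lt_min invr_gt0 s0.
have := expansion_uniq e1 e2 => /(congr1 (fun x => x m)) ->.
by rewrite mulrC mulKf // pnatr_eq0.
Qed.

End Solution.

Theorem proposition3p20 (R : realType) (Q : quiver) (U : set R[i]^o)
    (lam : arrow Q -> qpath Q -> R[i]^o -> R[i]^o)
    (U_open : open U) (U0 : U 0)
    (lam_analytic : forall a, analytic_family U (lam a))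
    (lam_const : forall a v t, U t -> lam a (ptriv v) t = 0)
    (lam_parallel : forall a w t, U t -> ~~ parallel a w -> lam a w t = 0) :
  exists V : set R[i]^o, [/\ open V, V 0, V `<=` U &
    exists gam : arrow Q -> qpath Q -> R[i]^o -> R[i]^o,
      [/\ (forall b w, analytic_on V (gam b w)) /\ ivp_solution V lam gam,
          forall gam' : arrow Q -> qpath Q -> R[i]^o -> R[i]^o,
            (forall b w, analytic_on V (gam' b w)) ->
            ivp_solution V lam gam' ->
            forall b w t, V t -> gam' b w t = gam b w t,
          forall t, V t ->
            invertible (fun b => (fun w => gam b w t) : cpathalg R[i] Q) &
          forall b, analytic_family V (gam b)]].
Proof.
have [e e0 eU] : exists2 e : R, 0 < e & forall t : R[i], normc t < e -> U t.
  have /nearcP[e e0 h] : \forall t \near (0 : R[i]^o), U t by exact: open_nbhs_nbhs.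
  by exists e => // t te; apply: h; rewrite subr0.
have /choice[Ma MaP] (a : arrow Q) : exists M : R, 0 < M /\
    forall t w, U t -> normc (lam a w t) <= M ^+ plen w.
  have [_ [M M0 h]] := lam_analytic a; exists M; split => // t w Ut.
  by rewrite normc_le rmorphXn; exact: h.
(* One constant for all the finitely many arrows, at least 1 as [sol_coef_bound] requires. *)
pose L : R := 1 + \sum_a Ma a.
have MaL a : Ma a <= L.
  rewrite /L (bigD1 a) //= addrCA lerDl addr_ge0 // sumr_ge0 // => b _.
  by have [/ltW] := MaP b.
have L1 : 1 <= L by rewrite lerDl sumr_ge0 // => b _; have [/ltW] := MaP b.
have L0 : 0 <= L := le_trans ler01 L1.
have e4 : 0 < e / 4 by rewrite divr_gt0.
(* The square of half-side e / 4 lies in the disc of radius e / 2. *)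
have sqU (t : R[i]) : normi t <= e / 4 -> U t.
  move=> ht; apply: eU; apply: (le_lt_trans (normc_le_normi t)); lra.
pose q : R := 2 / (e / 4); have q0 : 0 < q by rewrite divr_gt0.
(* The bound 0 for non-parallel pairs forces their Taylor coefficients to vanish. *)
have /choice[l lP] (x : arrow Q * qpath Q) : exists c : nat -> R[i],
    pbound (if parallel x.1 x.2 then L ^+ plen x.2 else 0) q c /\
    forall t, q * normc t < 1 -> hasps c t (lam x.1 x.2 t).
  case: x => a w /=.
  have [||c cb ch] := @bounded_power_series R (lam a w) _
      (if parallel a w then L ^+ plen w else 0) e4.
  - by move=> t /sqU; apply: analytic_on_at; case: (lam_analytic a).
  - move=> t /sqU Ut; case: ifPn => [_|np];
    last by rewrite lam_parallel // Normc.normc0.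
    have [M0 h] := MaP a; apply: le_trans (h _ _ Ut) _.
    by apply: lerXn2r; rewrite ?nnegrE ?(ltW M0).
  by exists c.
pose lc a w := l (a, w).
have lc_bound a w m : normc (lc a w m) <= L ^+ plen w * q ^+ m.
  have [h _] := lP (a, w); apply: le_trans (h m) _.
  rewrite ler_wpM2r ?exprn_ge0 ?(ltW q0) //=; case: ifP => // _.
  by rewrite exprn_ge0.
have lc_parallel a w m : ~~ parallel a w -> lc a w m = 0.
  move=> np; have [h _] := lP (a, w); have := h m;
    rewrite /= (negPf np) mul0r => h0.
  by apply/eqP; rewrite -normc_eq0 eq_le h0 normc_ge0.
have lc_hasps a w t : q * normc t < 1 -> hasps (lc a w) t (lam a w t).
  by have [_] := lP (a, w); apply.
have [A [B [A0 B0 cb]]] := sol_coef_bound L1 (ltW q0) lc_bound.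
pose c := sol_coef lc.
pose gam b w (t : R[i]) : R[i] := psv (c b w) t.
have gam_hasps b w (t : R[i]) : B * normc t < 1 -> hasps (c b w) t (gam b w t).
  by move=> Bt; have [] := pbound_hasps (ltW B0) Bt (cb b w).
have gam0 b w : gam b w 0 = init_coef R b w.
  by rewrite /gam (psv0 (ltW B0) (cb b w)) -picard_sol_coef.
have gam_par b w t : ~~ parallel b w -> gam b w t = 0.
  move=> np; rewrite /gam (_ : c b w = fun=> 0); first exact/hasps_psv/hasps_zero.
  by apply/funext => m; apply: sol_coef_parallel.
pose Lm (t : R[i]) := \matrix_(i < #|arrow Q|, j < #|arrow Q|)
  gam (enum_val i) (parrow (enum_val j)) t.
have [d d0 dL] : exists2 d : R, 0 < d & forall t : R[i], normc t < d -> \det (Lm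
  t) != 0.
  (* The Taylor coefficients of the determinant, from its expansion over permutations; the signs
     enter as constant series. *)
  pose dc : nat -> R[i] := fun n => \sum_(s : 'S_#|arrow Q|)
    conv (fun k => if k is 0 then (-1) ^+ s else 0)
      (cprod (fun i => c (enum_val i) (parrow (enum_val (s i))))) n.
  have hdet t : B * normc t < 1 -> hasps dc t (\det (Lm t)).
    move=> Bt; apply: hasps_sum => s _; apply: hasps_mul; first exact: hasps_cst.
    rewrite (eq_bigr (fun i => gam (enum_val i) (parrow (enum_val (s i))) t)).
      by apply: hasps_cprod => i; exact: gam_hasps.
    by move=> i _; rewrite mxE.
  have edet : expansion (fun t => \det (Lm t)) 0 dc.
    apply: (hasps_expansion (e := B^-1)); first by rewrite invr_gt0.
    by move=> t; rewrite subr0 => ht; apply: hdet; rewrite -ltr_pdivlMl // mulr1.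
  apply: (nonvanishing_near (ex_intro _ dc edet)).
  rewrite (_ : Lm 0 = 1%:M) ?det1 //.
  apply/matrixP => i j; rewrite !mxE gam0 /init_coef; congr (_ %:R);
    congr nat_of_bool.
  by rewrite -(inj_eq enum_val_inj) eq_sym; apply/eqP/eqP => [[]|->].
(* The four bounds ensure, in turn, that t lies in [U], that the lambda are given by their series,
   that the gamma obey the bound A^|w|, and that the determinant does not vanish. *)
pose r := Num.min (Num.min e q^-1) (Num.min (B^-1 / 2) d).
have r0 : 0 < r by rewrite !lt_min e0 d0 invr_gt0 q0 divr_gt0 // invr_gt0.
have rP (t : R[i]) : normc t < r -> [/\ normc t < e, q * normc t < 1,
    B * normc t <= 2^-1, B * normc t < 1 & normc t < d].
  rewrite !lt_min => /andP[/andP[te tq] /andP[tB td]].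
  have B2 : B * normc t <= 2^-1 by rewrite -ler_pdivlMl // ltW.
  split => //; first by rewrite -ltr_pdivlMl // mulr1.
  by apply: le_lt_trans B2 _; lra.
pose V : set R[i]^o := [set t | normc t < r].
have V_open : open V.
  rewrite openE => t Vt; apply/nearcP; exists (r - normc t);
    first by rewrite subr_gt0.
  by move=> z hz; rewrite /V /= -(subrK t z) (le_lt_trans (normcD _ _)) // -ltrBrDr.
have gam_analytic b w : forall t : R[i], V t -> analytic_at (gam b w) t.
  by move=> t /rP[_ _ _ Bt _]; exact: analytic_psv B0 Bt (cb b w).
have n0 : normc (0 : R[i]) < r by rewrite Normc.normc0.
have V0 : V 0 := n0.
exists V; split => //.
  by move=> t /rP[te _ _ _ _]; exact: eU.
have ivp : ivp_solution (R := R) V lam gam.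
  move=> b w; split.
  - move=> t Vt; have [_ tq _ Bt _] := rP t Vt.
    have st : 0 < r - normc t by rewrite subr_gt0.
    apply: (is_derive_psv B0 Bt (cb b w) st) => //.
    have [_] : hasps (rhs_coef lc c b w) t (ode_rhs (R := R) lam gam b w t).
      by apply: hasps_ode_rhs => [p|us a u _ _]; [exact: lc_hasps|exact: gam_hasps].
    rewrite (_ : rhs_coef lc c b w = fun n => n.+1%:R * sol_coef lc b w n.+1) //.
    apply/funext => n; rewrite -picard_sol_coef /= mulrC divfK // pnatr_eq0 //.
  - by move=> np t _; exact: gam_par.
  - move=> a; rewrite gam0 /init_coef; congr (_ %:R); congr nat_of_bool.
    by rewrite eq_sym; apply/eqP/eqP => [[]|->].
  - move=> w1; rewrite gam0 /init_coef; case: eqP => // e1.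
    by move: w1; rewrite /plen e1.
exists gam; split.
- by split => // b w; apply: analytic_at_on => t; exact: gam_analytic.
- move=> gam' gan' ivp' b w t Vt.
  have /choice[c' c'P] (x : arrow Q * qpath Q) :
      exists c0 : nat -> R[i], expansion (gam' x.1 x.2) 0 c0.
    case: x => a u /=.
    exact: (analytic_on_at (gan' a u) V0).
  have fixc' := @ivp_coefs R Q lc (fun a u => c' (a, u)) lam gam' V r r0
    (fun t h => h) (fun a p t tr => lc_hasps a p t (let: And5 _ h _ _ _ := rP t
      tr in h))
    ivp' (fun a u => c'P (a, u)).
  have c'E a u : c' (a, u) = c a u.
    by apply/funext => m; exact: (sol_coef_uniq fixc').
  (* Equal coefficients give equality only on a disc depending on b and w; the identity theorem
     carries it to all of [V]. *)
  have h0 : forall z : R[i], normc z < r -> gam' b w z - gam b w z = 0.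
    apply: (@identity_theorem R (fun z => gam' b w z - gam b w z : R[i]) r).
      move=> z zr; apply: analytic_sub; last exact: gam_analytic.
      exact: analytic_on_at (gan' b w) zr.
    have [s s0 hs] := expansion_hasps (c'P (b, w)).
    exists (Num.min s r); first by rewrite lt_min s0.
    move=> z; rewrite lt_min => /andP[zs zr]; have [_ _ _ Bz _] := rP z zr.
    have := hs z; rewrite subr0 /= c'E => /(_ zs) h1.
    by rewrite (hasps_uniq h1 (gam_hasps b w z Bz)) subrr.
  by apply/eqP; rewrite -subr_eq0; apply/eqP/h0.
- move=> t Vt; have [_ _ _ Bt td] := rP t Vt.
  have [N [NL LN]] := det_inverse (L := fun a b => gam a (parrow b) t) (dL t td).
  apply: (invertible_linear_part (N := N)) => //.
    by move=> a w; exact: gam_par.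
  move=> a v; rewrite /gam (_ : c a (ptriv v) = fun=> 0).
    exact/hasps_psv/hasps_zero.
  by apply/funext => m; exact: sol_coef_triv.
- move=> b; split; first by move=> w; apply: analytic_at_on => t;
  exact: gam_analytic.
  exists A => // t w Vt; have [_ _ B2 _ _] := rP t Vt.
  rewrite -rmorphXn -normc_le.
  (* The factor 2 of [psv_near0] cancels the 1 / 2 of [sol_coef_bound]. *)
  rewrite [leRHS](_ : _ = 2 * (A ^+ plen w / 2)); last by field.
  exact: psv_near0 B0 (cb b w) B2.
Qed.
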